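(* Let $d\in\mathbb{N}$, $L=(L_1,\dots,L_d)\in\mathbb{R}^d$ with $\|L\|=1$, and $\mu\in\mathbb{R}\setminus\{0\}$. Let $f:\mathbb{R}^d\to\mathbb{C}$ be defined by $$f(x)=\mathrm{e}^{-\frac{2\pi^2}{\mu}\langle L,x\rangle^2}\,\Phi(L_2x_1-L_1x_2,\;L_3x_1-L_1x_3,\;\dots,\;L_dx_1-L_1x_d),$$ where $\Phi$ is an arbitrary continuously differentiable function of $d-1$ real variables such that $\mathrm{UP}_L(f)$ makes sense (that is, $f\neq 0$ and $f\in\mathcal{D}(\mathcal{A}_L)\cap\mathcal{D}(\mathcal{B}_L)$). Then $\mathrm{UP}_L(f)=\frac14$.
   Context: Notation: $\langle x,y\rangle=x_1y_1+\dots+x_dy_d$ and $\|x\|=\sqrt{\langle x,x\rangle}$ for $x,y\in\mathbb{R}^d$; $\|f\|_2$ is the norm of $L_2(\mathbb{R}^d)$ (complex-valued functions), $\langle f,g\rangle=\int_{\mathbb{R}^d} f\overline{g}$. For $L\in\mathbb{R}^d\setminus\{0\}$, $\frac{\partial f}{\partial L}=\sum_{j=1}^d L_j\frac{\partial f}{\partial x_j}$. Define the operators $$\mathcal{A}_Lf(x)=2\pi\langle L,x\rangle f(x),\qquad \mathcal{B}_Lf(x)=\frac{\mathrm{i}}{2\pi}\frac{\partial f}{\partial L}(x),$$ with $\mathcal{D}(\mathcal{A}_L)=\{f\in L_2(\mathbb{R}^d):\int_{\mathbb{R}^d}\|x\|^2|f(x)|^2\,\mathrm{d}x<\infty\}$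 and $\mathcal{D}(\mathcal{B}_L)=H^1(\mathbb{R}^d)$ (functions in $L_2(\mathbb{R}^d)$ whose first-order derivatives are all in $L_2(\mathbb{R}^d)$). The variance of a non-zero $f$ with respect to an operator $\mathcal{A}$ is $\Delta(\mathcal{A},f)=\|\mathcal{A}f\|_2^2-\frac{|\langle\mathcal{A}f,f\rangle|^2}{\|f\|_2^2}$. The directional uncertainty product of a non-zero $f\in\mathcal{D}(\mathcal{A}_L)\cap\mathcal{D}(\mathcal{B}_L)$ along $L$ is $$\mathrm{UP}_L(f)=\frac{\Delta(\mathcal{A}_L,f)\,\Delta(\mathcal{B}_L,f)}{\|L\|^4\|f\|_2^4}.$$ For $d=1$ the function $\Phi$ is understood to be a constant. *)

(* Defs.v *)
From HB Require Import structures.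
From mathcomp Require Import all_boot all_order all_algebra.
From mathcomp Require Import all_classical all_reals all_analysis.
From mathcomp Require Import complex.

Set Implicit Arguments.
Unset Strict Implicit.
Unset Printing Implicit Defensive.

Import Order.TTheory GRing.Theory Num.Theory.
Import numFieldNormedType.Exports.

Local Open Scope classical_set_scope.
Local Open Scope ring_scope.
Local Open Scope complex_scope.

Definition measure_rV_display : measure_display -> measure_display.
Proof. exact. Qed.

Section measurable_rV.
Context {d} {T : measurableType d}.
Variable n : nat.

Let coors : 'I_n -> 'rV[T]_n -> T := fun i v => v ord0 i.

Let rV_set0 : g_sigma_preimage coors set0.
Proof. exact: sigma_algebra0. Qed.

Let rV_setC A : g_sigma_preimage coors A -> g_sigma_preimage coors (~` A).
Proof. exact: sigma_algebraC. Qed.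

Let rV_bigcup (F : _^nat) : (forall i, g_sigma_preimage coors (F i)) ->
  g_sigma_preimage coors (\bigcup_i (F i)).
Proof. exact: sigma_algebra_bigcup. Qed.

HB.instance Definition _ := @isMeasurable.Build (measure_rV_display d)
  'rV[T]_n (g_sigma_preimage coors) rV_set0 rV_setC rV_bigcup.

End measurable_rV.

Lemma measurable_rV_coord d (T : measurableType d) n (i : 'I_n) :
  measurable_fun [set: 'rV[T]_n] (fun v => v ord0 i).
Proof.
move=> _ Y mY; rewrite setTI; apply: sub_sigma_algebra => /=.
rewrite -bigcup_seq/=; exists i => /=; first by rewrite mem_index_enum.
by exists Y => //; rewrite setTI.
Qed.

Lemma measurable_fun_rVP d1 d2 (T1 : measurableType d1) (T2 : measurableType d2)
    n (f : T1 -> 'rV[T2]_n) :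
  measurable_fun [set: T1] f <->
  forall i, measurable_fun [set: T1] (fun x => f x ord0 i).
Proof.
split=> [mf i|mf].
  exact: (measurableT_comp (measurable_rV_coord i) mf).
apply: (@measurability _ _ _ _ _ _
  (\big[setU/set0]_(i < n) preimage_set_system setT
      (fun v : 'rV[T2]_n => v ord0 i) measurable)) => //.
move=> _ [B + <-].
rewrite -bigcup_seq/= => -[i _ [C mC <-]].
by rewrite !setTI -[X in measurable X]setTI; exact: mf.
Qed.

Definition cons_rV (T : Type) n (p : T * 'rV[T]_n) : 'rV[T]_n.+1 :=
  \row_(i < n.+1) oapp (p.2 ord0) p.1 (unlift ord0 i).

Lemma measurable_cons_rV d (T : measurableType d) n :
  measurable_fun [set: T * 'rV[T]_n] (@cons_rV T n).
Proof.
apply/measurable_fun_rVP => i; rewrite /cons_rV.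
under eq_fun do rewrite mxE.
case: (unlift ord0 i) => [j|] /=; last exact: measurable_fst.
exact: (measurableT_comp (measurable_rV_coord j) measurable_snd).
Qed.



Section lebesgue_rV.
Variable R : realType.

Section cons_measure.
Variables (n : nat) (mu : {sigma_finite_measure set 'rV[R]_n -> \bar R}).

Let prod := (@lebesgue_measure R \x mu)%E.

Let measurable_cons :
  measurable_fun [set: (measurableTypeR R * 'rV[R]_n)%type] (@cons_rV R n).
Proof. exact: measurable_cons_rV. Qed.

(* Transport of the product of the one-dimensional Lebesgue measure and mu. *)
Definition cons_measure : set 'rV[R]_n.+1 -> \bar R :=
  pushforward prod (@cons_rV R n).

HB.instance Definition _ := Measure.copy cons_measure
  (measure_function_pushforward__canonical__measure_function_Measure
     prod measurable_cons).

Let cons_measure_sigma_finite : sigma_finite setT cons_measure.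
Proof.
have /sigma_finiteP[F [TF ndF Foo]] := sigma_finiteT (@lebesgue_measure R).
have /sigma_finiteP[G [TG ndG Goo]] := sigma_finiteT mu.
pose uncons (v : 'rV[R]_n.+1) : (measurableTypeR R * 'rV[R]_n)%type :=
  (v ord0 ord0, \row_j v ord0 (lift ord0 j)).
have consK : cancel (@cons_rV R n) uncons.
  move=> [x v]; rewrite /uncons /cons_rV mxE unlift_none /=; congr pair.
  by apply/rowP => j; rewrite !mxE liftK.
have muncons : measurable_fun setT uncons.
  apply/measurable_fun_pairP; split.
    exact: (measurable_rV_coord ord0).
  apply/measurable_fun_rVP => i /=.
  under eq_fun do rewrite mxE.
  exact: measurable_rV_coord.
exists (fun k => uncons @^-1` (F k `*` G k)).
  rewrite predeqE => v; split=> // _.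
  have [i _ Fi] : (\bigcup_k F k) (uncons v).1 by rewrite -TF.
  have [j _ Gj] : (\bigcup_k G k) (uncons v).2 by rewrite -TG.
  exists (maxn i j) => //; split.
    by move: Fi; exact/subsetPset/ndF/leq_maxl.
  by move: Gj; exact/subsetPset/ndG/leq_maxr.
move=> k; have [mF Fk] := Foo k; have [mG Gk] := Goo k; split.
  by rewrite -[X in measurable X]setTI; apply: muncons => //; exact: measurableX.
rewrite /cons_measure /pushforward -comp_preimage.
rewrite (_ : uncons \o _ = id); last by apply/funext => p /=; exact: consK.
by rewrite preimage_id /prod product_measure1E// lte_mul_pinfty// ge0_fin_numE.
Qed.

HB.instance Definition _ := @Measure_isSigmaFinite.Build _ _ _
  cons_measure cons_measure_sigma_finite.

End cons_measure.

Fixpoint lebesgue_rV n : {sigma_finite_measure set 'rV[R]_n -> \bar R} :=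
  if n is m.+1 then cons_measure (lebesgue_rV m) else dirac (0 : 'rV[R]_0).

Lemma lebesgue_rV_box n (A : 'I_n -> set R) :
  (forall i, measurable (A i)) ->
  lebesgue_rV n [set v | forall i, A i (v ord0 i)] =
  (\prod_(i < n) lebesgue_measure (A i))%E.
Proof.
elim: n A => [|n IH] A mA.
  by rewrite big_ord0 /= diracE mem_set// => -[].
have mB : measurable [set v : 'rV[R]_n | forall i, A (lift ord0 i) (v ord0 i)].
  rewrite (_ : mkset _ = \bigcap_(i in setT)
      ((fun v : 'rV[R]_n => v ord0 i) @^-1` A (lift ord0 i))); last first.
    by apply/seteqP; split=> v /= h i; [move=> _; exact: h|exact: (h i)].
  apply: fin_bigcap_measurable => // i _.
  by rewrite -[X in measurable X]setTI; exact: measurable_rV_coord.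
rewrite big_ord_recl -IH//= /cons_measure /pushforward.
rewrite [RHS](_ : _ = (@lebesgue_measure R \x lebesgue_rV n)%E (A ord0 `*`
    [set v : 'rV[R]_n | forall i, A (lift ord0 i) (v ord0 i)])); last first.
  by apply: esym; apply: product_measure1E => //; exact: mA.
congr product_measure1.
apply/seteqP; split=> -[x v] /=.
  move=> h; split=> [|i]; first by have := h ord0; rewrite mxE unlift_none.
  by have := h (lift ord0 i); rewrite mxE liftK.
move=> [/= Ax Av] i; rewrite mxE.
by case: unliftP => [j|] -> //=; exact: Av.
Qed.

End lebesgue_rV.

Section uncertainty.
Variables (R : realType) (d : nat).
Local Notation V := 'rV[R]_d.
Local Notation mu := (lebesgue_rV R d).

Definition dot (x y : V) : R := \sum_(i < d) x ord0 i * y ord0 i.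

(* The library norm of a row vector is the sup norm. *)
Definition enorm (x : V) : R := Num.sqrt (dot x x).

Definition partial (j : 'I_d) (g : V -> R) : V -> R :=
  'D_(delta_mx ord0 j) g.

(* Differentiability and partial derivatives are stated for real-valued
   functions because R[i] carries no normed structure over R; complex-valued
   functions are treated through their real and imaginary parts. *)
Definition C1 (g : V -> R) : Prop :=
  (forall x, differentiable g x) /\ (forall j, continuous (partial j g)).

Definition Cinfty (g : V -> R) : Prop :=
  forall (s : seq 'I_d) x, differentiable (foldr partial g s) x.

Definition test_function (g : V -> R) : Prop :=
  Cinfty g /\ compact (closure [set x | g x != 0]).

Definition normc (z : R[i]) : R := complex.Re `|z|.

Definition cmeasurable (f : V -> R[i]) : Prop :=
  measurable_fun setT (fun x => complex.Re (f x)) /\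
  measurable_fun setT (fun x => complex.Im (f x)).

Definition cintegral (f : V -> R[i]) : R[i] :=
  (\int[mu]_x complex.Re (f x)) +i* (\int[mu]_x complex.Im (f x)).

(* Elements of L2 are represented by everywhere-defined Borel functions. *)
Definition L2 (f : V -> R[i]) : Prop :=
  cmeasurable f /\ ('N[mu]_2%:E [EFin \o (normc \o f)] < +oo)%E.

Definition L2norm (f : V -> R[i]) : R :=
  fine 'N[mu]_2%:E [EFin \o (normc \o f)].

Definition L2inner (f g : V -> R[i]) : R[i] :=
  cintegral (fun x => f x * (g x)^*).

(* g is the j-th distributional derivative of f. *)
Definition weak_partial_of (j : 'I_d) (f g : V -> R[i]) : Prop :=
  forall phi : V -> R, test_function phi ->
    cintegral (fun x => f x * (partial j phi x)%:C) =
    - cintegral (fun x => g x * (phi x)%:C).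

Definition H1 (f : V -> R[i]) : Prop :=
  L2 f /\ forall j, exists g, L2 g /\ weak_partial_of j f g.

(* A chosen representative of the j-th weak derivative: for f in H1 one exists
   and it is unique up to null sets; otherwise the value is irrelevant. *)
Definition weak_partial (j : 'I_d) (f : V -> R[i]) : V -> R[i] :=
  xget (fun=> 0) [set g | L2 g /\ weak_partial_of j f g].

Definition weak_dir_deriv (L : V) (f : V -> R[i]) : V -> R[i] :=
  fun x => \sum_(j < d) (L ord0 j)%:C * weak_partial j f x.

Definition opA (L : V) (f : V -> R[i]) : V -> R[i] :=
  fun x => (2 * pi * dot L x)%:C * f x.

Definition opB (L : V) (f : V -> R[i]) : V -> R[i] :=
  fun x => 'i / (2 * pi)%:C * weak_dir_deriv L f x.

Definition domA (f : V -> R[i]) : Prop :=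
  L2 f /\ (\int[mu]_x (enorm x ^+ 2 * normc (f x) ^+ 2)%:E < +oo)%E.

Definition domB (f : V -> R[i]) : Prop := H1 f.

(* Non-zero as an element of L2. *)
Definition nonzero (f : V -> R[i]) : Prop := ~ {ae mu, forall x, f x = 0}.

Definition variance (A : (V -> R[i]) -> (V -> R[i])) (f : V -> R[i]) : R :=
  L2norm (A f) ^+ 2 - normc (L2inner (A f) f) ^+ 2 / L2norm f ^+ 2.

Definition UP (L : V) (f : V -> R[i]) : R :=
  variance (opA L) f * variance (opB L) f / (enorm L ^+ 4 * L2norm f ^+ 4).

End uncertainty.

(* Main.v *)
Require Import Defs.
From mathcomp Require Import all_boot all_order all_algebra.
From mathcomp Require Import all_classical all_reals all_analysis.
From mathcomp Require Import measurable_realfun complex.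
From mathcomp Require Import ring lra.

Set Implicit Arguments.
Unset Strict Implicit.
Unset Printing Implicit Defensive.

Import Order.TTheory GRing.Theory Num.Theory.
Import numFieldNormedType.Exports.

Local Open Scope classical_set_scope.
Local Open Scope ring_scope.
Local Open Scope complex_scope.

(** Write s = <L, x> and a = 2 pi^2 / mu.  The arguments of Phi are linear forms
    vanishing on L, so f is Gaussian along L:
      f (x + t L) = exp (- a (2 s t + t^2)) f x.
    Formally this says that the derivative of f along L is - 2 a s f, so that
    A f = 2 pi s f and B f is - i a / pi times s f: the two operators agree on f
    up to a constant, which is the equality case of the uncertainty principle.
    Both mean values are multiples of the first moment of s for the density
    |f|^2, and both squared norms are multiples of its second moment M.  The product of
    the variances is therefore 4 a^2 M^2, and it remains to see that the first
    moment vanishes and that 4 a M = |f|_2^2.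

    The moments follow from translation invariance of Lebesgue measure alone
    ([ge0_integral_rV_shift]): translating |f|^2 along L computes the integral of
    exp (4 a s t) |f|^2 as exp (2 a t^2) |f|_2^2 for every t
    ([gaussian_laplace]), and the first two derivatives at t = 0 give the moments
    ([gaussian_moments]).

    The weak derivatives of f are only known through test functions.  Products of
    one-variable smooth functions of compact support are test functions
    ([test_function_tensor]), and there are enough of them to approximate the
    indicators of open boxes, hence to detect a square-integrable function up to
    null sets ([sqintegrable_ae0]).  Against such a product, translation by t L
    moves the difference quotient onto f, where it is explicit; letting t tend to
    0 gives integration by parts along L ([Rintegral_gaussian_parts]) and
    identifies the weak derivative as - 2 a s f ([gaussian_weak_derivative]). *)

(** * Translation invariance of Lebesgue measure *)

Lemma lebesgue_measure_shift (R : realType) (c : R) (A : set R) :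
  measurable A ->
  pushforward (@lebesgue_measure R) (fun x => x + c : measurableTypeR R) A =
  lebesgue_measure A.
Proof.
have mc : measurable_fun [set: R] (fun x => x + c : measurableTypeR R).
  exact: measurable_funD.
move=> mA; apply/esym.
apply: (@lebesgue_measure_unique R
  (measure_function_pushforward__canonical__measure_function_Measure
    (@lebesgue_measure R) mc)) => //= _ [[a b]] _ <-.
rewrite /pushforward /=.
rewrite (_ : _ @^-1` _ = `]a - c, b - c]%classic); last first.
  by apply/seteqP; split => x /=; rewrite !in_itv/= ltrBlDr lerBrDr.
rewrite !lebesgue_measure_itv/= !lte_fin ltrD2r; case: ifP => // _.
by rewrite -!EFinD; congr EFin; ring.
Qed.

Lemma ge0_integral_shift (R : realType) (c : R) (F : R -> \bar R) :
  measurable_fun [set: R] F -> (forall x, 0 <= F x)%E ->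
  (\int[@lebesgue_measure R]_x F (x + c)%R = \int[@lebesgue_measure R]_x F x)%E.
Proof.
move=> mF F0.
have mc : measurable_fun [set: R] (fun x => x + c : measurableTypeR R).
  exact: measurable_funD.
rewrite -[LHS](@ge0_integral_pushforward _ _ (measurableTypeR R)
  (measurableTypeR R) R _ mc (@lebesgue_measure R) setT F)//.
apply: eq_measure_integral => /= A mA _.
exact: lebesgue_measure_shift.
Qed.

Lemma measurable_rV_shift (R : realType) n (w : 'rV[R]_n) :
  measurable_fun [set: 'rV[R]_n] (fun x => x + w).
Proof.
apply/measurable_fun_rVP => i; under eq_fun do rewrite mxE.
by apply: measurable_funD => //; exact: measurable_rV_coord.
Qed.

Lemma ge0_integral_lebesgue_rVS (R : realType) n (F : 'rV[R]_n.+1 -> \bar R) :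
  measurable_fun setT F -> (forall x, 0 <= F x)%E ->
  (\int[lebesgue_rV R n.+1]_x F x =
   \int[@lebesgue_measure R]_x \int[lebesgue_rV R n]_v F (cons_rV (x, v)))%E.
Proof.
move=> mF F0.
have mFc : measurable_fun setT (F \o @cons_rV R n).
  exact: measurableT_comp mF (measurable_cons_rV (n := n)).
have mc : measurable_fun [set: (measurableTypeR R * 'rV[R]_n)%type]
    (@cons_rV R n) by exact: measurable_cons_rV.
rewrite -[RHS](@fubini_tonelli1 _ _ (measurableTypeR R) _ R
  (@lebesgue_measure R) (lebesgue_rV R n) (F \o @cons_rV R n) mFc); last first.
  by move=> x; exact: F0.
have <- := @ge0_integral_pushforward _ _ _ _ R _ mc
  (@lebesgue_measure R \x lebesgue_rV R n)%E setT F measurableT mF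
  (fun x _ => F0 x).
by apply: eq_measure_integral => A mA _.
Qed.

(** Lebesgue measure on row vectors is built one coordinate at a time, so its
    translation invariance reduces by Tonelli to that of the line. *)
Lemma ge0_integral_rV_shift (R : realType) n (w : 'rV[R]_n)
    (F : 'rV[R]_n -> \bar R) :
  measurable_fun setT F -> (forall x, 0 <= F x)%E ->
  (\int[lebesgue_rV R n]_x F (x + w)%R = \int[lebesgue_rV R n]_x F x)%E.
Proof.
elim: n w F => [|n IH] w F mF F0.
  by apply: eq_integral => x _; congr F; apply/rowP; case.
pose w' : 'rV[R]_n := \row_j w ord0 (lift ord0 j).
have mFw : measurable_fun setT (fun x : 'rV[R]_n.+1 => F (x + w)).
  exact: measurableT_comp mF (measurable_rV_shift w).
rewrite !ge0_integral_lebesgue_rVS//.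
have shiftE (x : R) v : cons_rV (x, v) + w = cons_rV (x + w ord0 ord0, v + w').
  apply/rowP => i; rewrite !mxE.
  by case: unliftP => [j|] -> //=; rewrite !mxE.
have mcons x : measurable_fun setT (fun v : 'rV[R]_n => cons_rV (x, v)).
  exact: measurableT_comp (measurable_cons_rV (n := n)) (measurable_pair1 x).
pose G (x : R) := (\int[lebesgue_rV R n]_v F (cons_rV (x, v)))%E.
transitivity (\int[@lebesgue_measure R]_x G (x + w ord0 ord0)%R)%E.
  apply: eq_integral => /= x _.
  rewrite /G -(IH w' (fun v => F (cons_rV (x + w ord0 ord0, v))))//.
    by apply: eq_integral => /= v _; rewrite shiftE.
  exact: measurableT_comp mF (mcons _).
apply: (@ge0_integral_shift R (w ord0 ord0) G).
  apply: (@measurable_fun_fubini_tonelli_F _ _ (measurableTypeR R) _ R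
    (lebesgue_rV R n) (F \o @cons_rV R n)) => /=.
  - exact: measurableT_comp mF (measurable_cons_rV (n := n)).
  - by move=> x; exact: F0.
by move=> x; exact: integral_ge0.
Qed.

Lemma integral_rV_shift (R : realType) n (w : 'rV[R]_n) (F : 'rV[R]_n -> R) :
  measurable_fun setT F ->
  \int[lebesgue_rV R n]_x F (x + w) = \int[lebesgue_rV R n]_x F x.
Proof.
move=> mF; rewrite /Rintegral; congr fine.
rewrite integralE [RHS]integralE; congr (_ - _)%E.
- rewrite -[RHS](ge0_integral_rV_shift w)//; last first.
    by apply: measurable_funepos; exact/measurable_EFinP.
  by apply: eq_integral => x _; rewrite !funeposE.
- rewrite -[RHS](ge0_integral_rV_shift w)//; last first.
    by apply: measurable_funeneg; exact/measurable_EFinP.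
  by apply: eq_integral => x _; rewrite !funenegE.
Qed.

(** * Smooth functions of one variable with compact support *)

Section smooth.
Variable R : realType.
Implicit Types (g h : R -> R) (p : {poly R}).

Fixpoint smooth_upto (k : nat) g : Prop :=
  (forall x : R, derivable g x (1 : R)) /\
  (if k is k'.+1 then smooth_upto k' g^`()%classic else True).

Definition smooth g : Prop := forall k, smooth_upto k g.

Lemma smooth_derivable g (x : R) : smooth g -> derivable g x (1 : R).
Proof. by move=> /(_ 0%N)[]. Qed.

Lemma smooth_is_derive g (x : R) : smooth g -> is_derive x (1 : R) g (g^`()%classic x).
Proof.
by move=> sg; apply: DeriveDef; [exact: smooth_derivable|rewrite derive1E].
Qed.

Lemma smooth_continuous g : smooth g -> continuous g.
Proof.
by move=> sg x; apply/differentiable_continuous/derivable1_diffP/smooth_derivable.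
Qed.

Lemma smooth_derive g : smooth g -> smooth g^`()%classic.
Proof. by move=> sg k; case: (sg k.+1). Qed.

Lemma smooth_uptoW k g : smooth_upto k.+1 g -> smooth_upto k g.
Proof. by elim: k g => [|k IH] g [dg] /=; [move=> _|move=> /IH]. Qed.

Lemma smooth_uptoD k g h :
  smooth_upto k g -> smooth_upto k h -> smooth_upto k (g + h).
Proof.
elim: k g h => [|k IH] g h [dg sg] [dh sh] /=.
  by split=> [x|//]; exact: derivableD.
split; first by move=> x; exact: derivableD.
rewrite (_ : (g + h)^`()%classic = g^`()%classic + h^`()%classic).
  exact: IH.
by apply/funext => x; rewrite !fctE !derive1E deriveD.
Qed.

Lemma smooth_uptoM k g h :
  smooth_upto k g -> smooth_upto k h -> smooth_upto k (g * h).
Proof.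
elim: k g h => [|k IH] g h.
  by move=> [dg _] [dh _]; split=> [x|//]; exact: derivableM.
move=> sg sh; have [dg sg'] := sg; have [dh sh'] := sh.
split; first by move=> x; exact: derivableM.
rewrite (_ : (g * h)^`()%classic = g * h^`()%classic + h * g^`()%classic).
  by apply: smooth_uptoD; apply: IH => //; exact: smooth_uptoW.
by apply/funext => x; rewrite !fctE !derive1E deriveM.
Qed.

Lemma smoothM g h : smooth g -> smooth h -> smooth (g * h).
Proof. by move=> sg sh k; exact: smooth_uptoM. Qed.

(** Smoothness by coinduction: exhibiting a stable family replaces computing
    higher derivatives. *)
Lemma smooth_family (P : set (R -> R)) :
  (forall g, P g -> (forall x : R, derivable g x (1 : R)) /\ P g^`()%classic) ->
  forall g, P g -> smooth g.
Proof.
move=> HP g Pg k; elim: k g Pg => [|k IH] g Pg /=; have [dg Pg'] := HP _ Pg.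
  by [].
by split=> //; exact: IH.
Qed.

Lemma is_derive1_quadratic g (x C : R) :
  (forall t, `|g (t + x) - g x| <= C * t ^+ 2) -> is_derive x (1 : R) g 0.
Proof.
move=> gC.
have cvg0 : (fun t => t^-1 *: ((g \o shift x) (t *: 1) - g x)) @ 0^' --> (0 : R).
  apply/cvgr0Pnorm_le => e e0.
  near=> t.
  have h0 : t != 0 by near: t; exact: nbhs_dnbhs_neq.
  rewrite (_ : _ *: _ = t^-1 * (g (t + x) - g x)); last first.
    by rewrite /= [t *: 1]mulr1.
  rewrite normrM normfV mulrC ler_pdivrMr ?normr_gt0//.
  apply: le_trans (gC t) _.
  rewrite -normr_id -real_normK ?num_real// expr2 mulrA normr_id.
  rewrite ler_wpM2r//.
  apply: (@le_trans _ _ ((`|C| + 1) * `|t|)).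
    by rewrite ler_wpM2r// (le_trans (ler_norm _))// lerDl.
  rewrite mulrC -ler_pdivlMr ?ltr_wpDl//.
  near: t; apply: dnbhs0_le; rewrite divr_gt0// ltr_wpDl//.
by apply: DeriveDef; [apply/cvg_ex; exists 0|exact/cvg_lim].
Unshelve. all: by end_near. Qed.

Lemma exprn_mul_expRN_le m y : 0 <= y -> y ^+ m * expR (- y) <= m`!%:R :> R.
Proof.
move=> y0; rewrite expRN ler_pdivrMr ?expR_gt0// -ler_pdivrMl ?ltr0n ?fact_gt0//.
case: m => [|m]; first by rewrite expr0 fact0 invr1 mulr1 -expR0 ler_expR.
by apply: le_trans (expR_ge1Dxn m y0); rewrite mulrC lerDr.
Qed.

Lemma horner_mul_expRN_bounded p :
  exists2 C, 0 <= C & forall y, 0 <= y -> `|p.[y] * expR (- y)| <= C.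
Proof.
exists (\sum_(i < size p) `|p`_i| * i`!%:R) => [|y y0].
  by apply: sumr_ge0 => i _; rewrite mulr_ge0.
rewrite horner_coef mulr_suml (le_trans (ler_norm_sum _ _ _))// ler_sum// => i _.
rewrite -mulrA normrM ler_wpM2l// ger0_norm ?exprn_mul_expRN_le//.
by rewrite mulr_ge0 ?expR_ge0 ?exprn_ge0.
Qed.

(** The germs p(1/u) exp(-1/u), cut off at u <= 0 and read along u = c x + d:
    p = 1 is the classical flat function, and the polynomial factor makes the
    family closed under differentiation. *)
Definition flat (c d : R) p (x : R) : R :=
  let u := c * x + d in if 0 < u then p.[u^-1] * expR (- u^-1) else 0.

Lemma flat_quadratic c d p :
  exists2 C, 0 <= C & forall x, `|flat c d p x| <= C * (Num.max 0 (c * x + d)) ^+ 2.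
Proof.
have [C C0 HC] := horner_mul_expRN_bounded (p * 'X^2).
exists C => // x; rewrite /flat; set u := c * x + d.
case: ltP => u0; last by rewrite normr0 expr0n/= mulr0.
have := HC u^-1; rewrite invr_ge0 ltW// => /(_ isT).
rewrite hornerM hornerXn mulrAC normrM [X in _ * X <= _]ger0_norm; last first.
  by rewrite exprn_ge0// invr_ge0 ltW.
by rewrite exprVn ler_pdivrMr// exprn_gt0.
Qed.

(** For u > 0 this is the chain rule.  At and below u = 0 the function vanishes
    on one side and is quadratically small on the other, so its derivative is
    0, which is also the value of the right-hand side there. *)
Lemma flat_is_derive c d p x :
  is_derive x (1 : R) (flat c d p) (flat c d (c *: ('X^2 * (p - p^`()))) x).
Proof.
have ucont : continuous (fun x : R => c * x + d).
  by move=> y; apply: cvgD; [apply: cvgM => //; exact: cvg_cst|exact: cvg_cst].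
have [u0|u0] := ltP 0 (c * x + d); last first.
  rewrite [X in is_derive _ _ _ X](_ : _ = 0); last first.
    by rewrite /flat ltNge u0.
  have [C C0 HC] := flat_quadratic c d p.
  apply: (@is_derive1_quadratic _ _ (C * c ^+ 2)) => t.
  rewrite [flat c d p x](_ : _ = 0) ?subr0; last by rewrite /flat ltNge u0.
  apply: le_trans (HC _) _; rewrite -mulrA ler_wpM2l// -exprMn.
  have [v0|_] := ltP 0 (c * (t + x) + d); last by rewrite expr0n/= sqr_ge0.
  have vct : c * (t + x) + d <= c * t by rewrite mulrDr -addrA gerDl.
  by rewrite ler_sqr ?nnegrE ?(ltW v0)// (le_trans (ltW v0)).
have nearu : \near x, (fun y => p.[(c * y + d)^-1] * expR (- (c * y + d)^-1)) x
   = flat c d p x.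
  near=> y; rewrite /flat ifT//; near: y.
  exact: (cvgr_gt _ (ucont x)).
apply: near_eq_is_derive nearu _.
have u_neq0 : c * x + d != 0 by rewrite gt_eqF.
have du : is_derive x (1 : R) (fun y : R => c * y + d) c.
  have -> : (fun y : R => c * y + d) = c \*: (@id R) + cst d by [].
  apply: (is_derive_eq (is_deriveD (is_deriveZ c (is_derive_id x _))
    (is_derive_cst d x _))).
  by rewrite addr0 [_ *: _]mulr1.
have dV := @is_deriveV R (fun y => c * y + d) x _ _ u_neq0 du.
have dp := @is_derive1_comp R (horner p) _ x _ _ (is_derive_poly p _) dV.
have de := @is_derive1_comp R expR _ x _ _ (is_derive_expR _) (is_deriveN dV).
refine (@is_derive_eq _ _ _ _ _ _ _ _ (is_deriveM dp de) _).
rewrite /flat u0 /= !hornerE /GRing.scale /= -!exprVn.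
set v := (c * x + d)^-1.
ring.
Unshelve. all: by end_near. Qed.

Lemma flat_smooth c d p : smooth (flat c d p).
Proof.
apply: (@smooth_family [set g | exists q, g = flat c d q]); last by exists p.
move=> _ [q ->]; split=> [x|].
  by have [] := flat_is_derive c d q x.
exists (c *: ('X^2 * (q - q^`()))); apply/funext => x.
by rewrite derive1E; have [_ ->] := flat_is_derive c d q x.
Qed.

(** The slopes k + 1 make the two flat factors steeper, so that the product tends
    to the indicator of ]a, b[. *)
Definition flat_bump (a b : R) (k : nat) : R -> R :=
  flat k.+1%:R (- k.+1%:R * a) 1 * flat (- k.+1%:R) (k.+1%:R * b) 1.

Lemma flat_bump_smooth a b k : smooth (flat_bump a b k).
Proof. by apply: smoothM; exact: flat_smooth. Qed.

Lemma flat1_ge0_le1 c d x : 0 <= flat c d 1 x <= 1.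
Proof.
rewrite /flat hornerC mul1r; case: ltP => u0; last by rewrite lexx ler01.
by rewrite expR_ge0 expR_le1 oppr_le0 invr_ge0 ltW.
Qed.

Lemma flat_bump_ge0_le1 a b k x : 0 <= flat_bump a b k x <= 1.
Proof.
rewrite /flat_bump [X in 0 <= X <= 1]/GRing.mul /=.
have /andP[g0 g1] := flat1_ge0_le1 k.+1%:R (- k.+1%:R * a) x.
have /andP[h0 h1] := flat1_ge0_le1 (- k.+1%:R) (k.+1%:R * b) x.
by rewrite mulr_ge0// mulr_ile1.
Qed.

Lemma flat_bump_out a b k x : ~~ (a < x < b) -> flat_bump a b k x = 0.
Proof.
rewrite /flat_bump [X in X = 0]/GRing.mul /= negb_and -!leNgt => /orP[xa|bx].
  rewrite [X in X * _](_ : _ = 0) ?mul0r// /flat mulNr -mulrBr.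
  by rewrite pmulr_rgt0 ?ltr0n// subr_gt0 ltNge xa.
rewrite [X in _ * X](_ : _ = 0) ?mulr0// /flat mulNr addrC -mulrBr.
by rewrite pmulr_rgt0 ?ltr0n// subr_gt0 ltNge bx.
Qed.

Lemma cvg_flat1 z : 0 < z ->
  (fun k => expR (- (k.+1%:R * z)^-1)) @ \oo --> (1 : R).
Proof.
move=> z0; rewrite -[X in _ --> X]expR0.
have c0 : (fun k => - (k.+1%:R * z)^-1) @ \oo --> (0 : R); last first.
  exact: (cvg_comp _ _ c0 (@continuous_expR R 0)).
have h0 : (fun k => (k.+1%:R)^-1 * z^-1) @ \oo --> (0 * z^-1 : R).
  by apply: cvgM; [exact: cvg_harmonic|exact: cvg_cst].
have := cvgN h0; rewrite mul0r oppr0 => h1.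
have -> : (fun k => - (k.+1%:R * z)^-1) = - (fun k : nat => (k.+1%:R)^-1 * z^-1).
  by apply/funext => k; rewrite !fctE invfM.
exact: h1.
Qed.

Lemma cvg_bump (a b x : R) :
  (fun k => flat_bump a b k x) @ \oo --> ((a < x < b)%R%:R : R).
Proof.
case: (boolP (a < x < b)) => [/andP[ax xb]|xab]; last first.
  rewrite (_ : (fun k => flat_bump a b k x) = cst 0); first exact: cvg_cst.
  by apply/funext => k /=; exact: flat_bump_out.
rewrite -[X in _ --> X]mulr1.
rewrite (_ : (fun k => flat_bump a b k x) =
   (fun k => expR (- (k.+1%:R * (x - a))^-1)) \*
   (fun k => expR (- (k.+1%:R * (b - x))^-1))).
  by apply: cvgM; apply: cvg_flat1; rewrite subr_gt0.
apply/funext => k; rewrite /flat_bump {1}/GRing.mul /= /flat.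
have -> : k.+1%:R * x + - k.+1%:R * a = k.+1%:R * (x - a) by ring.
have -> : - k.+1%:R * x + k.+1%:R * b = k.+1%:R * (b - x) by ring.
by rewrite !pmulr_rgt0 ?ltr0n// !subr_gt0 ax xb !hornerC !mul1r.
Qed.

Lemma derive1_out g (a b : R) : (forall x, ~~ (a <= x <= b) -> g x = 0) ->
  forall x, ~~ (a <= x <= b) -> g^`()%classic x = 0.
Proof.
move=> g0 x xab; rewrite derive1E.
have : \near x, cst 0 x = g x.
  move: xab; rewrite negb_and -!ltNge => /orP[xa|bx].
    near=> y; rewrite g0// negb_and -ltNge; apply/orP; left.
    by near: y; exact: lt_nbhsl.
  near=> y; rewrite g0// negb_and -!ltNge; apply/orP; right.
  by near: y; exact: lt_nbhsr.
by move=> /(@near_eq_derive _ _ _ _ _ _ (1 : R)) <-; rewrite derive_cst.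
Unshelve. all: by end_near. Qed.

Lemma smooth_out_bounded g (a b : R) :
  (forall x, ~~ (a <= x <= b) -> g x = 0) -> smooth g ->
  exists2 C, 0 <= C & forall x, `|g x| <= C.
Proof.
move=> g0 sg; have [ab|ba] := leP a b; last first.
  exists 0 => // x; rewrite g0 ?normr0//; apply/negP => /andP[ax xb].
  by have := le_trans ax xb; rewrite leNgt ba.
have cg : continuous (fun x => `|g x|).
  by move=> x; apply: cvg_norm; exact: smooth_continuous.
have [c _ gc] := EVT_max ab (continuous_subspaceT cg).
exists `|g c| => // x; have [xab|xab] := boolP (a <= x <= b).
  by apply: gc; rewrite in_itv.
by rewrite g0// normr0.
Qed.

End smooth.

(** * Tensor products as test functions *)

Section tensor.
Variables (R : realType) (d : nat).
Implicit Types (b : 'I_d -> R -> R) (v x : 'rV[R]_d).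

Definition tensor b (x : 'rV[R]_d) : R := \prod_(i < d) b i (x ord0 i).

Definition derive_factor j b (i : 'I_d) : R -> R :=
  if i == j then (b i)^`()%classic else b i.

Definition cube (M : R) : set 'rV[R]_d :=
  [set v | forall i, v ord0 i \in `[- M, M]].

Lemma is_derive_line (g : 'rV[R]_d -> R) x v (t : R) :
  derivable g (x + t *: v) v ->
  is_derive t (1 : R) (fun s : R => g (x + s *: v)) ('D_v g (x + t *: v)).
Proof.
move=> dg.
have E : (fun h : R => h^-1 *: (((fun s : R => g (x + s *: v)) \o shift t) (h *: 1)
     - g (x + t *: v))) =
  (fun h : R => h^-1 *: ((g \o shift (x + t *: v)) (h *: v) - g (x + t *: v))).
  apply/funext => h /=; congr (_ *: (g _ - _)).
  by rewrite [h *: 1](mulr1 h) scalerDl addrCA.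
by apply: DeriveDef; rewrite /derivable /derive E.
Qed.

Lemma differentiable_tensor b x : (forall i, smooth (b i)) ->
  differentiable (tensor b) x.
Proof.
move=> sb; rewrite /tensor.
elim: (index_enum _) => [|i s IH].
  under eq_fun do rewrite big_nil.
  exact: differentiable_cst.
under eq_fun do rewrite big_cons.
apply: differentiableM => //.
apply: (@differentiable_comp _ _ _ _ (fun x : 'rV[R]_d => x ord0 i) (b i)).
  exact: differentiable_coord.
exact/derivable1_diffP/smooth_derivable.
Qed.

(** Moving in the direction of the j-th basis vector only changes the j-th
    factor, so tensor products are stable under partial derivatives. *)
Lemma partial_tensor b j : (forall i, smooth (b i)) ->
  partial j (tensor b) = tensor (derive_factor j b).
Proof.
move=> sb; apply/funext => x; rewrite /partial.
pose v : 'rV[R]_d := delta_mx ord0 j.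
have := @is_derive_line (tensor b) x v 0.
rewrite scale0r addr0.
move=> /(_ (diff_derivable (v := v) (differentiable_tensor x sb)))[_ <-].
pose c := \prod_(i < d | i != j) b i (x ord0 i).
rewrite (_ : (fun s => _) = c \*: (b j \o shift (x ord0 j))); last first.
  apply/funext => s; rewrite /tensor (bigD1 j)//= mulrC /c; congr (_ * b j _).
    apply: eq_bigr => i ij; congr (b i _).
    by rewrite !mxE (negbTE ij) mulr0 addr0.
  by rewrite !mxE !eqxx mulr1 addrC.
have db := smooth_is_derive (shift (x ord0 j) 0) (sb j).
have ds := is_derive1_comp db (is_derive_shift 0 (1 : R) (x ord0 j)).
have [_ ->] := is_deriveZ c ds.
rewrite mulr1 /tensor (bigD1 j)//= mulrC /derive_factor eqxx /= add0r.
by congr (_ * _); apply: eq_bigr => i /negbTE ->.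
Qed.

Lemma derive_factor_smooth j b : (forall i, smooth (b i)) ->
  forall i, smooth (derive_factor j b i).
Proof.
by move=> sb i; rewrite /derive_factor; case: ifP => // _; exact: smooth_derive.
Qed.

Lemma Cinfty_tensor b : (forall i, smooth (b i)) -> Cinfty (tensor b).
Proof.
move=> sb s x.
suff [b' sb' ->] : exists2 b', (forall i, smooth (b' i)) &
    foldr (@partial R d) (tensor b) s = tensor b'.
  exact: differentiable_tensor.
elim: s => [|j s [b' sb' IH]]; first by exists b.
exists (derive_factor j b'); first exact: derive_factor_smooth.
by rewrite /= IH partial_tensor.
Qed.

Lemma compact_cube M : compact (cube M).
Proof.
by apply: (@rV_compact _ _ (fun=> `[- M, M]%classic)) => i; exact: segment_compact.
Qed.

Definition supported (M : R) b : Prop :=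
  forall i y, ~~ (- M <= y <= M) -> b i y = 0.

Lemma tensor_out M b x : supported M b -> ~ cube M x -> tensor b x = 0.
Proof.
move=> bM /existsNP[i /negP xi]; rewrite /tensor (bigD1 i)//= bM ?mul0r//.
Qed.

Lemma derive_factor_supported M j b : supported M b ->
  supported M (derive_factor j b).
Proof.
move=> bM i y yM; rewrite /derive_factor; case: ifP => _; last exact: bM.
by apply: (@derive1_out _ _ (- M) M) => //; exact: bM.
Qed.

Lemma test_function_tensor M b : (forall i, smooth (b i)) -> supported M b ->
  test_function (tensor b).
Proof.
move=> sb bM; split; first exact: Cinfty_tensor.
have clM : closed (cube M).
  apply: compact_closed; [exact: norm_hausdorff|exact: compact_cube].
apply: (subclosed_compact _ (@compact_cube M)); first exact: closed_closure.
rewrite [cube M](closure_id _).1//; apply: closureS => x /= /eqP x0.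
by apply: contrapT => /(tensor_out bM).
Qed.

Lemma tensor_bounded M b : (forall i, smooth (b i)) -> supported M b ->
  exists2 C, 0 <= C & forall x, `|tensor b x| <= C.
Proof.
move=> sb bM.
have /choice[C HC] : forall i, exists C, 0 <= C /\ forall y, `|b i y| <= C.
  by move=> i; have [C C0 HC] := smooth_out_bounded (bM i) (sb i); exists C.
exists (\prod_(i < d) C i) => [|x].
  by apply: prodr_ge0 => i _; have [] := HC i.
by rewrite normr_prod; apply: ler_prod => i _; rewrite normr_ge0/=; have [_] := HC i.
Qed.

Lemma tensor_le_cube M b : (forall i, smooth (b i)) -> supported M b ->
  exists2 C, 0 <= C & forall x, `|tensor b x| <= C * \1_(cube M) x.
Proof.
move=> sb bM; have [C C0 HC] := tensor_bounded sb bM; exists C => // x.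
rewrite indicE; have [xM|xM] := pselect (cube M x).
  by rewrite mem_set// mulr1.
by rewrite (tensor_out bM)// normr0 mulr_ge0.
Qed.

Lemma derive_tensor b v x : (forall i, smooth (b i)) ->
  'D_v (tensor b) x = \sum_(j < d) v ord0 j * partial j (tensor b) x.
Proof.
move=> sb; have dx := differentiable_tensor x sb.
rewrite deriveE// {1}[v]row_sum_delta linear_sum.
by apply: eq_bigr => j _; rewrite linearZ /partial deriveE //.
Qed.

Lemma measurable_tensor b : (forall i, smooth (b i)) ->
  measurable_fun setT (tensor b).
Proof.
move=> sb; apply: measurable_prod => i _.
have mb : measurable_fun setT (b i).
  exact: continuous_measurable_fun (smooth_continuous (sb i)).
exact: measurableT_comp mb (measurable_rV_coord i).
Qed.

End tensor.

(** * Square-integrable functions and boxes *)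

Section real_integrable.
Context d (T : measurableType d) (R : realType).
Variable mu : {measure set T -> \bar R}.
Implicit Types F G : T -> R.

Definition rintegrable F : Prop := mu.-integrable setT (EFin \o F).

Lemma rintegrable_measurable F : rintegrable F -> measurable_fun setT F.
Proof. by move=> /measurable_int /measurable_EFinP. Qed.

Lemma le_rintegrable F G : measurable_fun setT F ->
  (forall x, `|F x| <= G x) -> rintegrable G -> rintegrable F.
Proof.
move=> mF FG; apply: le_integrable => //; first exact/measurable_EFinP.
by move=> x _ /=; rewrite lee_fin (le_trans (FG x))// ler_norm.
Qed.

Lemma rintegrableD F G : rintegrable F -> rintegrable G ->
  rintegrable (fun x => F x + G x).
Proof. by move=> iF iG; exact: (integrableD measurableT iF iG). Qed.

Lemma rintegrableB F G : rintegrable F -> rintegrable G ->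
  rintegrable (fun x => F x - G x).
Proof. by move=> iF iG; exact: (integrableB measurableT iF iG). Qed.

Lemma rintegrableZ k F : rintegrable F -> rintegrable (fun x => k * F x).
Proof. by move=> iF; exact: (integrableZl measurableT k iF). Qed.

Lemma rintegrable_sum (I : Type) (s : seq I) (F : I -> T -> R) :
  (forall i, rintegrable (F i)) -> rintegrable (fun x => \sum_(i <- s) F i x).
Proof.
move=> iF; elim: s => [|i s IH].
  under eq_fun do rewrite big_nil; exact: integrable0.
under eq_fun do rewrite big_cons; exact: rintegrableD.
Qed.

Lemma Rintegral_sum (I : Type) (s : seq I) (F : I -> T -> R) :
  (forall i, rintegrable (F i)) ->
  \int[mu]_x (\sum_(i <- s) F i x) = \sum_(i <- s) \int[mu]_x F i x.
Proof.
move=> iF; elim: s => [|i s IH].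
  by under eq_Rintegral do rewrite big_nil; rewrite Rintegral_cst// mul0r big_nil.
under eq_Rintegral do rewrite big_cons; rewrite big_cons -IH.
apply: RintegralD => //; first exact: iF.
exact: rintegrable_sum.
Qed.

Lemma cvg_rintegrable (F_ : nat -> T -> R) F G :
  (forall n, measurable_fun setT (F_ n)) ->
  (forall x, (fun n => F_ n x) @ \oo --> F x) ->
  rintegrable G -> (forall n x, `|F_ n x| <= G x) -> rintegrable F.
Proof.
move=> mF_ F_F iG F_G; apply: le_rintegrable iG => [|x].
  exact: measurable_fun_cvg mF_ (fun x _ => F_F x).
have FxF : (fun n => `|F_ n x|) @ \oo --> `|F x| by exact: cvg_norm.
by apply: (cvgr_to_le FxF); exact: nearW.
Qed.

Lemma cvg_Rintegral (F_ : nat -> T -> R) F G :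
  (forall n, measurable_fun setT (F_ n)) ->
  (forall x, (fun n => F_ n x) @ \oo --> F x) ->
  rintegrable G -> (forall n x, `|F_ n x| <= G x) ->
  (fun n => \int[mu]_x F_ n x) @ \oo --> \int[mu]_x F x.
Proof.
move=> mF_ F_F iG F_G.
have iF : rintegrable F by exact: cvg_rintegrable F_G.
rewrite /Rintegral; apply: fine_cvg; rewrite fineK; last exact: integrable_fin_num.
apply: (@dominated_cvg _ _ _ mu setT measurableT (fun n => EFin \o F_ n)
  (EFin \o F) (EFin \o G)) => //=.
- by move=> n; exact/measurable_EFinP.
- by move=> x _; apply: cvg_EFin; [exact: nearW|exact: F_F].
- by move=> n x _; rewrite lee_fin.
Qed.

Definition sqintegrable F : Prop :=
  measurable_fun setT F /\ rintegrable (fun x => F x ^+ 2).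

Lemma sqintegrableM F G : sqintegrable F -> sqintegrable G ->
  rintegrable (fun x => F x * G x).
Proof.
move=> [mF iF] [mG iG]; apply: le_rintegrable (rintegrableD iF iG).
  exact: measurable_funM.
move=> x; rewrite normrM -(real_normK (num_real (F x))) -(real_normK (num_real (G x))).
by move: `|F x| `|G x| => u v; nra.
Qed.

Lemma sqintegrableZ k F : sqintegrable F -> sqintegrable (fun x => k * F x).
Proof.
move=> [mF iF]; split; first exact: measurable_funM.
by under eq_fun do rewrite exprMn; exact: rintegrableZ.
Qed.

Lemma sqintegrableD F G : sqintegrable F -> sqintegrable G ->
  sqintegrable (fun x => F x + G x).
Proof.
move=> F2 G2; have [mF iF] := F2; have [mG iG] := G2.
split; first exact: measurable_funD.
under eq_fun do rewrite sqrrD -mulr_natl.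
apply: rintegrableD => //; apply: rintegrableD => //.
by apply: rintegrableZ; exact: sqintegrableM.
Qed.

End real_integrable.

Section boxes.
Variables (R : realType) (d : nat).
Local Notation V := 'rV[R]_d.
Local Notation mu := (lebesgue_rV R d).
Implicit Types (F G : V -> R) (a c : 'I_d -> R).

Lemma measurable_rV_sets (A : 'I_d -> set R) : (forall i, measurable (A i)) ->
  measurable [set v : V | forall i, A i (v ord0 i)].
Proof.
move=> mA; rewrite (_ : mkset _ = \bigcap_(i in setT)
    ((fun v : V => v ord0 i) @^-1` A i)); last first.
  by apply/seteqP; split=> v /= h i; [move=> _; exact: h|exact: (h i)].
apply: fin_bigcap_measurable => // i _.
by rewrite -[X in measurable X]setTI; exact: measurable_rV_coord.
Qed.

Lemma measurable_cube M : measurable (@cube R d M).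
Proof. exact: (@measurable_rV_sets (fun=> `[- M, M]%classic)). Qed.

Lemma sqintegrable_cube M : sqintegrable mu (\1_(@cube R d M) : V -> R).
Proof.
split; first exact: measurable_indic (measurable_cube M).
rewrite (_ : (fun x => _) = \1_(@cube R d M)); last first.
  by apply/funext => x; rewrite indicE; case: (_ \in _); rewrite ?expr0n ?expr1n.
apply/integrableP; split.
  by apply/measurable_EFinP; apply: measurable_indic; exact: measurable_cube.
under eq_integral => x _ do rewrite gee0_abs ?lee_fin//.
rewrite integral_indic ?setIT//; last exact: measurable_cube.
have : (\prod_(i < d) @lebesgue_measure R `[(- M)%R, M]%classic)%E \is a fin_num.
  elim/big_ind : _ => //; first by move=> x y; exact: fin_numM.
  by move=> i _; rewrite lebesgue_measure_itv/=; case: ifP.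
rewrite -(@lebesgue_rV_box R d (fun=> `[- M, M]%classic))// fin_numElt => /andP[_].
exact.
Qed.

Definition open_box a c : set V := [set v | forall i, a i < v ord0 i < c i].

Lemma measurable_open_box a c : measurable (open_box a c).
Proof.
have -> : open_box a c =
    [set v : V | forall i, `]a i, c i[%classic (v ord0 i)].
  by apply/seteqP; split=> v h i; have := h i; rewrite /= in_itv.
by apply: (@measurable_rV_sets (fun i => `]a i, c i[%classic)).
Qed.

Definition open_boxes : set (set V) :=
  [set B | exists a c, B = open_box a c].

Lemma setI_closed_open_boxes : setI_closed open_boxes.
Proof.
move=> _ _ [a [c ->]] [a' [c' ->]].
exists (fun i => Num.max (a i) (a' i)), (fun i => Num.min (c i) (c' i)).
apply/seteqP; split => [v [h h'] i|v h].
  by have /andP[h1 h2] := h i; have /andP[h3 h4] := h' i;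
     rewrite gt_max lt_min h1 h2 h3 h4.
by split=> i; have := h i; rewrite gt_max lt_min;
   move=> /andP[/andP[h1 h2] /andP[h3 h4]]; rewrite ?h1 ?h2 ?h3 ?h4.
Qed.

Lemma rV_bounded (v : V) : exists k : nat, forall i, - k%:R < v ord0 i < k%:R.
Proof.
pose s := \sum_i `|v ord0 i|.
exists (Num.truncn s).+1 => i; rewrite -ltr_norml.
apply: (@le_lt_trans _ _ s); last exact: truncnS_gt.
by rewrite /s (bigD1 i)//= lerDl sumr_ge0.
Qed.

(** The half-space where the i-th coordinate exceeds x is the countable union of
    the boxes of side ]max x (-k), k[ in direction i and ]-k, k[ in the others. *)
Lemma measurable_open_boxes : @measurable _ V = <<s open_boxes >>.
Proof.
apply/seteqP; split; last first.
  apply: smallest_sub; first exact: sigma_algebra_measurable.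
  by move=> _ [a [c ->]]; exact: measurable_open_box.
apply: smallest_sub; first exact: smallest_sigma_algebra.
move=> A; rewrite -bigcup_seq/= => -[i _ [B mB <-]].
have : measurable_fun [set: g_sigma_algebraType open_boxes]
    (fun v : V => v ord0 i).
  apply: (measurability _ (RGenOInfty.measurableE R)).
  move=> _ [_ [x ->] <-]; rewrite setTI.
  rewrite (_ : _ @^-1` _ = \bigcup_k open_box
     (fun j => if j == i then Num.max x (- k%:R) else - k%:R) (fun=> k%:R)).
    apply: bigcupT_measurable => k; apply: sub_sigma_algebra.
    by do 2 eexists.
  apply/seteqP; split => [v|v [k _ /(_ i)]]/=; rewrite in_itv/= andbT.
    move=> xv; have [k vk] := rV_bounded v; exists k => // j.
    have /andP[kv ->] := vk j; rewrite andbT; case: eqP => // ->.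
    by rewrite gt_max xv; have /andP[] := vk i.
  by rewrite eqxx gt_max => /andP[/andP[]].
by move=> /(_ measurableT _ mB).
Qed.
End boxes.

(** * The fundamental lemma of the calculus of variations *)

Section fundamental_lemma.
Variables (R : realType) (d : nat).
Local Notation V := 'rV[R]_d.
Local Notation mu := (lebesgue_rV R d).
Implicit Types (F G : V -> R) (a c : 'I_d -> R) (b : 'I_d -> R -> R).

Lemma sqintegrableM_cube F (psi : V -> R) (C M : R) : sqintegrable mu F ->
  measurable_fun setT psi ->
  (forall x : V, `|psi x| <= C * \1_(@cube R d M) x) ->
  rintegrable mu (fun x => F x * psi x).
Proof.
move=> F2 mpsi psiC; apply: sqintegrableM => //; split=> //.
have [_ i1] := sqintegrableZ C (sqintegrable_cube d M).
apply: le_rintegrable i1 => [|x]; first exact: measurable_funX.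
rewrite normrX lerXn2r ?nnegrE//.
by rewrite (le_trans _ (psiC x)).
Qed.

(** Tensor products of [flat_bump] converge boundedly to the indicator of the
    box, within a fixed cube. *)
Lemma Rintegral_open_box0 G a c : sqintegrable mu G ->
  (forall M b, (forall i, smooth (b i)) -> supported M b ->
    \int[mu]_x (G x * tensor b x) = 0) ->
  \int[mu]_x (G x * \1_(open_box a c) x) = 0.
Proof.
move=> G2 HG; pose M := \sum_i (`|a i| + `|c i|).
pose b k i := flat_bump (a i) (c i) k.
have sb k i : smooth (b k i) by exact: flat_bump_smooth.
have aM i : `|a i| + `|c i| <= M.
  by rewrite /M (bigD1 i)//= lerDl sumr_ge0// => j _; rewrite addr_ge0.
have bM k : supported M (b k).
  move=> i y yM; apply: flat_bump_out; apply: contra yM => /andP[ay yc].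
  have := aM i; have := normr_ge0 (a i); have := normr_ge0 (c i).
  have := ler_norm (c i); have := ler_norm (- a i); rewrite normrN.
  by move: ay yc => + + *; move=> *; apply/andP; split; lra.
have tb k x : `|tensor (b k) x| <= \1_(@cube R d M) x.
  rewrite indicE; have [xM|xM] := pselect (cube M x); last first.
    by rewrite (tensor_out (bM k) xM) normr0.
  rewrite mem_set// ger0_norm; last first.
    apply: prodr_ge0 => i _.
    by have /andP[] := flat_bump_ge0_le1 (a i) (c i) k (x ord0 i).
  by apply: prodr_ile1 => i _; exact: flat_bump_ge0_le1.
have cvgb (x : V) : (fun k => tensor (b k) x) @ \oo --> (\1_(open_box a c) x : R).
  have -> : \1_(open_box a c) x = \prod_(i < d) (a i < x ord0 i < c i)%R%:R :> R.
    rewrite indicE; have [xB|xB] := pselect (open_box a c x).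
      by rewrite mem_set// big1// => i _; rewrite xB.
    rewrite memNset//; move/existsNP : xB => [i /negP/negbTE xi].
    by rewrite (bigD1 i)//= xi mul0r.
  apply: (@cvg_big R 'I_d *%R 1 xpredT (@mul_continuous R)
    nat \oo (index_enum _) (fun i k => b k i (x ord0 i))) => i _.
  exact: cvg_bump.
have : (fun k => \int[mu]_x (G x * tensor (b k) x)) @ \oo -->
    \int[mu]_x (G x * \1_(open_box a c) x).
  apply: (@cvg_Rintegral _ _ _ _ _ _ (fun x => `|G x * \1_(@cube R d M) x|)).
  - move=> k; apply: measurable_funM; first exact: G2.1.
    exact: measurable_tensor.
  - by move=> x; apply: cvgM; [exact: cvg_cst|exact: cvgb].
  - apply: integrable_norm.
    apply: (@sqintegrableM_cube _ _ 1 M) => //.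
      by apply: measurable_indic; exact: measurable_cube.
    by move=> x; rewrite mul1r ger0_norm.
  - by move=> k x; rewrite !normrM ler_wpM2l// (le_trans (tb k x))// ler_norm.
under eq_fun do rewrite (HG M)//.
by move=> /(cvg_unique (@Rhausdorff R) (cvg_cst 0)) <-.
Qed.

(** Open boxes generate the Borel sets and are stable under intersection, so the
    vanishing of the integrals of G over boxes spreads, by Dynkin's argument, to
    all Borel subsets.  G need not be integrable on the whole space, hence the
    truncation to the cubes Q k. *)
Lemma sqintegrable_ae0 G : sqintegrable mu G ->
  (forall M b, (forall i, smooth (b i)) -> supported M b ->
    \int[mu]_x (G x * tensor b x) = 0) ->
  {ae mu, forall x, G x = 0}.
Proof.
move=> G2 HG.
pose Q k : set V := open_box (fun=> - k%:R) (fun=> k%:R).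
pose Gk k x := G x * \1_(Q k) x.
have mQ k : measurable (Q k) by exact: measurable_open_box.
have QC k x : Q k x -> cube k%:R x.
  by move=> xQ i; have /andP[h1 h2] := xQ i; rewrite in_itv/= !ltW.
have iGk k : rintegrable mu (Gk k).
  apply: (@sqintegrableM_cube G (\1_(Q k)) 1 k%:R) => //.
  move=> x; rewrite mul1r ger0_norm// !indicE.
  have [xQ|xQ] := pselect (Q k x); last by rewrite (memNset xQ).
  by rewrite (mem_set xQ) mem_set//; exact: QC.
have fin0 (F : V -> R) : rintegrable mu F -> \int[mu]_x F x = 0 ->
    (\int[mu]_x (F x)%:E = 0)%E.
  by move=> iF F0; rewrite -[LHS]fineK ?integrable_fin_num//; congr EFin.
have Gk0 k (A : set V) : measurable A -> (\int[mu]_(x in A) (Gk k x)%:E = 0)%E.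
  rewrite measurable_open_boxes => sA.
  apply: (dynkin_induction (@measurable_open_boxes R d)
    (@setI_closed_open_boxes R d)
    (P := fun A => (\int[mu]_(x in A) (Gk k x)%:E = 0)%E)) _ _ _ _ _ sA.
  - by apply: fin0 => //; exact: Rintegral_open_box0.
  - move=> _ [a [c ->]] /=.
    have [a' [c' QE]] : open_boxes (Q k `&` open_box a c).
      by apply: setI_closed_open_boxes; do 2 eexists.
    rewrite integral_mkcond -[RHS](fin0 (fun x => G x * \1_(open_box a' c') x)).
    - apply: eq_integral => x _; rewrite patchE -QE.
      have -> : \1_(Q k `&` open_box a c) x = \1_(Q k) x * \1_(open_box a c) x :> R.
        by rewrite indicI.
      rewrite mulrA -/(Gk k x) [\1_(open_box _ _) x]indicE.
      by case: ifP => xB; rewrite ?mulr1 ?mulr0.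
    - rewrite -QE.
      apply: (@sqintegrableM_cube G (\1_(Q k `&` open_box a c)) 1 k%:R) => //.
        apply: measurable_indic; apply: measurableI => //.
        exact: measurable_open_box.
      move=> x; rewrite mul1r ger0_norm// !indicE.
      have [xQ|xQ] := pselect (Q k x); last by rewrite memNset// => -[].
      rewrite (mem_set (QC _ _ xQ)) ler_nat leq_b1//.
    - exact: Rintegral_open_box0.
  - move=> B mB B0; have : (\int[mu]_(x in B `|` ~` B) (Gk k x)%:E = 0)%E.
      by rewrite setUv; apply: fin0 => //; exact: Rintegral_open_box0.
    rewrite integral_setU//; first by rewrite B0 add0e.
    - exact: measurableC.
    - by apply: measurable_funTS; exact: measurable_int (iGk k).
    - exact/disj_setPCl.
  - move=> F mF tF F0; rewrite integral_bigcup//; first by rewrite eseries0.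
    by apply: integrableS (iGk k) => //; exact: bigcup_measurable.
have aek k : {ae mu, forall x, Gk k x = 0}.
  have : ae_eq mu setT (EFin \o Gk k) (cst 0%E).
    apply: integral_ae_eq => //; first exact: iGk.
    by move=> A _ mA; rewrite integral0 Gk0.
  by apply: filterS => x /(_ I)[].
have := ae_foralln aek; apply: filterS => x Gkx.
have [k xk] := rV_bounded x; have := Gkx k.
by rewrite /Gk indicE mem_set// mulr1.
Qed.

End fundamental_lemma.

(** * Integration by parts along a Gaussian direction *)

Section difference_quotient.
Variable R : realType.
Implicit Types (g : R -> R) (y l : R).

Lemma cvg_difference_quotient g (r : nat -> R) l :
  r @ \oo --> (0 : R) -> (forall k, r k != 0) ->
  is_derive (0 : R) (1 : R) g l ->
  (fun k : nat => (r k)^-1 * (g (r k) - g 0)) @ \oo --> l.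
Proof.
move=> r0 r_neq0 [dg <-].
have r0' : r @ \oo --> (0 : R)^'.
  move=> P /r0 P0; have : \forall k \near \oo, r k != 0 -> P (r k) by exact: P0.
  by apply: filterS => k /=; apply.
have -> : (fun k : nat => (r k)^-1 * (g (r k) - g 0)) =
    (fun h : R => h^-1 *: ((g \o shift 0) (h *: 1) - g 0)) \o r.
  by apply/funext => k /=; rewrite addr0 [_ *: 1]mulr1.
exact: (cvg_comp _ _ r0' dg).
Qed.

Lemma le_abs_expR_sub1 y : `|expR y - 1| <= `|y| * expR `|y|.
Proof.
have [y0|y0] := leP 0 y.
  rewrite !ger0_norm ?subr_ge0//; last by rewrite -expR0 ler_expR.
  have := ler_wpM2r (expR_ge0 y) (expR_ge1Dx (- y)).
  by rewrite -expRD addNr expR0; lra.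
rewrite ler0_norm ?subr_le0; last by rewrite -expR0 ler_expR ltW.
apply: (@le_trans _ _ `|y|); last by rewrite ler_peMr// -expR0 ler_expR.
by rewrite ltr0_norm//; have := expR_ge1Dx y; lra.
Qed.

End difference_quotient.

Section gaussian_direction.
Variables (R : realType) (d : nat).
Local Notation V := 'rV[R]_d.
Local Notation mu := (lebesgue_rV R d).
Implicit Types (F G : V -> R) (L x : V) (b : 'I_d -> R -> R).

Lemma dotDr L x y : dot L (x + y) = dot L x + dot L y.
Proof.
by rewrite /dot -big_split; apply: eq_bigr => i _; rewrite mxE mulrDr.
Qed.

Lemma dotZr L (t : R) x : dot L (t *: x) = t * dot L x.
Proof.
by rewrite /dot mulr_sumr; apply: eq_bigr => i _; rewrite mxE mulrCA.
Qed.

Lemma measurable_dot L : measurable_fun setT (dot L).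
Proof.
apply: measurable_sum => i; apply: measurable_funM => //.
exact: measurable_rV_coord.
Qed.

(** When |L| = 1, this says that F is a multiple of exp (- a s^2) on every line of
    direction L, with s = dot L x the position on the line. *)
Definition gaussian_along (a : R) L F : Prop :=
  forall x t, F (x + t *: L) = expR (- a * (2 * dot L x * t + t ^+ 2)) * F x.

Lemma abs_dot_cube L M x : cube M x -> `|dot L x| <= \sum_i `|L ord0 i| * M.
Proof.
move=> xM; rewrite /dot (le_trans (ler_norm_sum _ _ _))// ler_sum// => i _.
rewrite normrM ler_wpM2l// ler_norml.
by have := xM i; rewrite in_itv.
Qed.

Lemma derive_tensor_bounded M b L :
  (forall i, smooth (b i)) -> supported M b ->
  exists2 C, 0 <= C & forall x, `|'D_L (tensor b) x| <= C * \1_(@cube R d M) x.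
Proof.
move=> sb bM.
have /choice[C HC] : forall j : 'I_d, exists C, 0 <= C /\
    forall x, `|tensor (derive_factor j b) x| <= C.
  move=> j; have [C C0 HC] := tensor_bounded (derive_factor_smooth j sb)
    (@derive_factor_supported _ _ _ j _ bM).
  by exists C.
have C0 : 0 <= \sum_j `|L ord0 j| * C j.
  by apply: sumr_ge0 => j _; rewrite mulr_ge0//; have [] := HC j.
exists (\sum_j `|L ord0 j| * C j) => // x.
rewrite derive_tensor// indicE; have [xM|xM] := pselect (cube M x).
  rewrite mem_set// mulr1 (le_trans (ler_norm_sum _ _ _))// ler_sum// => j _.
  by rewrite normrM ler_wpM2l// partial_tensor//; have [_] := HC j.
rewrite memNset// mulr0 big1 ?normr0// => j _.
by rewrite partial_tensor// (tensor_out (@derive_factor_supported _ _ _ j _ bM)) ?mulr0.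
Qed.

(** Mean value theorem along the segment from x to x + t L, which can leave
    the cube by at most the size of L. *)
Lemma tensor_difference_quotient_bounded M b L :
  (forall i, smooth (b i)) -> supported M b ->
  exists C, forall x (t : R), 0 < t <= 1 ->
    `|t^-1 * (tensor b (x + t *: L) - tensor b x)| <=
    C * \1_(@cube R d (M + \sum_i `|L ord0 i|)) x.
Proof.
move=> sb bM; have [C C0 HC] := derive_tensor_bounded L sb bM.
exists C => x t /andP[t0 t1].
have [xM|xM] := pselect (cube (M + \sum_i `|L ord0 i|) x); last first.
  have out (y : V) : (forall i, `|y ord0 i| <= `|L ord0 i|) -> tensor b (x + y) = 0.
    move=> yL; apply: (tensor_out bM) => xyM; apply: xM => i.
    have := xyM i; have := yL i; rewrite !in_itv/= mxE -!ler_norml => yi xyi.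
    rewrite -[x ord0 i](addrK (y ord0 i)) (le_trans (ler_normB _ _))// lerD//.
    by rewrite (le_trans yi)// (bigD1 i)//= lerDl sumr_ge0.
  rewrite -{2}[x]addr0 !out ?subrr ?mulr0 ?normr0 ?mulr_ge0//.
    by move=> i; rewrite mxE normr0.
  by move=> i; rewrite mxE normrM ler_piMl// gtr0_norm.
rewrite indicE mem_set// mulr1.
have dline s : is_derive s (1 : R) (fun s : R => tensor b (x + s *: L))
    ('D_L (tensor b) (x + s *: L)).
  by apply: is_derive_line; apply: diff_derivable; exact: differentiable_tensor.
have [|c _] := @MVT R (fun s : R => tensor b (x + s *: L))
  (fun s => 'D_L (tensor b) (x + s *: L)) 0 t t0 (fun s _ => dline s).
  apply: continuous_subspaceT => s; apply: differentiable_continuous.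
  by apply/derivable1_diffP; have [] := dline s.
rewrite subr0 scale0r addr0 => ->; rewrite mulrCA mulVf ?gt_eqF// mulr1.
rewrite (le_trans (HC _))// indicE; case: (_ \in _); rewrite ?mulr1 ?mulr0//.
Qed.

(** Integration by parts along L.  By translation invariance, the integral of F
    against the difference quotient of the tensor product at step t is the
    integral of the tensor product against the difference quotient of F at step
    - t, which is F times an explicit exponential factor.  Both sides converge
    dominatedly as t tends to 0. *)
Lemma Rintegral_gaussian_parts a L F M b :
  dot L L = 1 -> gaussian_along a L F -> sqintegrable mu F ->
  (forall i, smooth (b i)) -> supported M b ->
  \int[mu]_x (F x * 'D_L (tensor b) x) =
  \int[mu]_x (2 * a * dot L x * F x * tensor b x).
Proof.
move=> LL FL F2 sb bM; pose phi := tensor b.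
have mphi : measurable_fun setT phi by exact: measurable_tensor.
have [C C0 phiC] := tensor_le_cube sb bM; rewrite -/phi in phiC.
have [C' psiC] := tensor_difference_quotient_bounded L sb bM.
pose t (k : nat) : R := k.+1%:R^-1.
have t01 k : 0 < t k <= 1.
  by rewrite invr_gt0 ltr0n/= invf_le1// ler1n.
have t_neq0 k : t k != 0 by have /andP[/gt_eqF ->] := t01 k.
have t_cvg0 : t @ \oo --> (0 : R) by exact: cvg_harmonic.
(* psi and chi are the difference quotients of phi and of the factor of F. *)
pose psi k x := (t k)^-1 * (phi (x + t k *: L) - phi x).
pose e x (u : R) := expR (a * (2 * dot L x * u - u ^+ 2)).
pose chi k x := (t k)^-1 * (e x (t k) - e x 0).
have e0 x : e x 0 = 1 by rewrite /e mulr0 expr0n/= subr0 mulr0 expR0.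
have mpsi k : measurable_fun setT (psi k).
  apply: measurable_funM => //; apply: measurable_funB => //.
  exact: measurableT_comp mphi (measurable_rV_shift _).
have mchi k : measurable_fun setT (chi k).
  apply: measurable_funM => //; apply: measurable_funB => //; last first.
    have -> : e^~ 0 = cst 1 by apply/funext => x; rewrite e0.
    exact: measurable_cst.
  apply: measurableT_comp => //; apply: measurable_funM => //.
  apply: measurable_funB => //; apply: measurable_funM => //.
  by apply: measurable_funM => //; exact: measurable_dot.
have psi_le k x : `|psi k x| <= C' * \1_(@cube R d (M + \sum_i `|L ord0 i|)) x.
  by rewrite /psi; exact: psiC.
(* K bounds the exponent of the factor divided by the step, for steps at most 1. *)
pose K := `|a| * (2 * (\sum_i `|L ord0 i| * M) + 1).
have chi_le k x : `|chi k x * phi x| <= K * expR K * C * \1_(@cube R d M) x.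
  have := phiC x; rewrite indicE normrM; have [xM|xM] := pselect (cube M x); last first.
    by rewrite memNset// !mulr0 => phi0; rewrite mulr_ge0_le0.
  rewrite mem_set// !mulr1 => phix; apply: ler_pM => //.
  have /andP[t0 t1] := t01 k.
  rewrite /chi e0 normrM gtr0_norm ?invr_gt0// mulrC ler_pdivrMr//.
  have yK : `|a * (2 * dot L x * t k - t k ^+ 2)| <= K * t k.
    rewrite normrM /K -[leRHS]mulrA ler_wpM2l// (le_trans (ler_normB _ _))//.
    rewrite [leRHS]mulrDl mul1r lerD//; last first.
      by rewrite ger0_norm ?sqr_ge0// expr2 ler_piMl// ltW.
    rewrite !normrM (gtr0_norm t0) ler_wpM2r ?(ltW t0)// ger0_norm// ler_wpM2l//.
    exact: abs_dot_cube.
  have K0 : 0 <= K by rewrite -(pmulr_lge0 _ t0) (le_trans _ yK).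
  apply: le_trans (le_abs_expR_sub1 _) _; rewrite [leRHS]mulrAC.
  apply: ler_pM => //.
  by rewrite ler_expR (le_trans yK)// ler_piMr.
have iFphi : rintegrable mu (fun x => F x * phi x) by exact: sqintegrableM_cube phiC.
have ipsi k : rintegrable mu (fun x => F x * psi k x).
  exact: sqintegrableM_cube (psi_le k).
have ichi k : rintegrable mu (fun x => F x * (chi k x * phi x)).
  by apply: sqintegrableM_cube (chi_le k) => //; exact: measurable_funM.
have parts k : \int[mu]_x (F x * psi k x) = \int[mu]_x (F x * (chi k x * phi x)).
  pose h x := F (x - t k *: L) * phi x.
  have mh : measurable_fun setT h.
    apply: measurable_funM => //.
    exact: measurableT_comp F2.1 (measurable_rV_shift (- (t k *: L))).
  have := @integral_rV_shift R d (t k *: L) h mh.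
  have -> : \int[mu]_x h (x + t k *: L) =
      \int[mu]_x (F x * phi x + t k * (F x * psi k x)).
    apply: eq_Rintegral => x _; rewrite /h addrK /psi.
    by field; exact: t_neq0.
  have -> : \int[mu]_x h x =
      \int[mu]_x (F x * phi x + t k * (F x * (chi k x * phi x))).
    apply: eq_Rintegral => x _; rewrite /h -scaleNr FL /chi e0 /e.
    rewrite (_ : - a * (2 * dot L x * - t k + (- t k) ^+ 2) =
      a * (2 * dot L x * t k - t k ^+ 2)); last by ring.
    by field; exact: t_neq0.
  rewrite !RintegralD//; try exact: rintegrableZ.
  rewrite (RintegralZl (t k) measurableT (ipsi k)).
  by rewrite (RintegralZl (t k) measurableT (ichi k)) => /addrI /(mulfI (t_neq0 k)).
have cvgpsi : (fun k => \int[mu]_x (F x * psi k x)) @ \oo -->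
    \int[mu]_x (F x * 'D_L phi x).
  apply: (@cvg_Rintegral _ _ _ _ _ _
    (fun x => `|F x * (C' * \1_(@cube R d (M + \sum_i `|L ord0 i|)) x)|)).
  - by move=> k; apply: measurable_funM => //; exact: F2.1.
  - move=> x; apply: cvgM; first exact: cvg_cst.
    rewrite /psi -{2}[x]addr0 -(scale0r L).
    apply: (@cvg_difference_quotient R (fun s => phi (x + s *: L)) t) => //.
    have := @is_derive_line R d phi x L 0; rewrite scale0r addr0; apply.
    by apply: diff_derivable; exact: differentiable_tensor.
  - apply: integrable_norm; apply: (sqintegrableM F2).
    exact: sqintegrableZ (sqintegrable_cube d _).
  - move=> k x; rewrite normrM [leRHS]normrM ler_wpM2l//.
    by rewrite (le_trans (psi_le k x))// ler_norm.
have cvgchi : (fun k => \int[mu]_x (F x * (chi k x * phi x))) @ \oo -->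
    \int[mu]_x (F x * (2 * a * dot L x * phi x)).
  apply: (@cvg_Rintegral _ _ _ _ _ _
    (fun x => `|F x * (K * expR K * C * \1_(@cube R d M) x)|)).
  - move=> k; apply: measurable_funM; first exact: F2.1.
    exact: measurable_funM.
  - move=> x; apply: cvgM; first exact: cvg_cst.
    apply: cvgM; last exact: cvg_cst.
    apply: (@cvg_difference_quotient R (e x) t) => //.
    pose p : {poly R} := a *: ((2 * dot L x) *: 'X - 'X^2).
    have -> : e x = expR \o horner p.
      by apply/funext => u; rewrite /e /p /= !hornerE.
    have := is_derive1_comp (is_derive_expR _) (is_derive_poly p 0).
    rewrite (_ : expR p.[0] * p^`().[0] = 2 * a * dot L x); first exact.
    rewrite /p derivZ derivB derivZ derivX derivXn !hornerE /=.
    rewrite expr0n /= oppr0 mulr0 expR0; ring.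
  - apply: integrable_norm; apply: (sqintegrableM F2).
    exact: sqintegrableZ (sqintegrable_cube d _).
  - move=> k x; rewrite normrM [leRHS]normrM ler_wpM2l//.
    by rewrite (le_trans (chi_le k x))// ler_norm.
rewrite (eq_fun parts) in cvgpsi.
have -> := cvg_unique (@Rhausdorff R) cvgpsi cvgchi.
by apply: eq_Rintegral => x _; rewrite mulrA [F x * _]mulrC.
Qed.

End gaussian_direction.

(** * Moments of a Gaussian density *)

Section gaussian_moments.
Variables (R : realType) (d : nat).
Local Notation V := 'rV[R]_d.
Local Notation mu := (lebesgue_rV R d).
Implicit Types (F : V -> R) (L x : V).

Lemma rintegrable_shift (w : V) F :
  rintegrable mu F -> rintegrable mu (fun x => F (x + w)).
Proof.
move=> iF; have mF := rintegrable_measurable iF.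
have mEF : measurable_fun setT (fun x => `|(F x)%:E|%E).
  by apply: measurableT_comp => //; exact/measurable_EFinP.
apply/integrableP; split.
  apply/measurable_EFinP.
  exact: measurableT_comp mF (measurable_rV_shift w).
have /integrableP[_] := iF.
by rewrite -(ge0_integral_rV_shift w mEF).
Qed.

(** Translating F ^+ 2 by - t L multiplies it by the exponential, up to a constant,
    and preserves its integral. *)
Lemma gaussian_laplace a L F (t : R) : dot L L = 1 -> gaussian_along a L F ->
  sqintegrable mu F ->
  rintegrable mu (fun x => expR (4 * a * dot L x * t) * F x ^+ 2) /\
  \int[mu]_x (expR (4 * a * dot L x * t) * F x ^+ 2) =
  expR (2 * a * t ^+ 2) * \int[mu]_x F x ^+ 2.
Proof.
move=> LL FL [mF iF].
have E x : expR (4 * a * dot L x * t) * F x ^+ 2 =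
    expR (2 * a * t ^+ 2) * F (x + (- t) *: L) ^+ 2.
  rewrite FL exprMn -expRM_natl [RHS]mulrA -expRD; congr (expR _ * _).
  by ring.
have iFt := rintegrable_shift (- t *: L) iF.
rewrite (eq_fun E); split.
  exact: rintegrableZ.
rewrite (RintegralZl _ measurableT iFt); congr (_ * _).
by rewrite (integral_rV_shift _ (F := fun x => F x ^+ 2))//; exact: measurable_funX.
Qed.

(** The moments are derivatives at 0 of the Laplace transform in [gaussian_laplace].
    The symmetric difference quotients D k of t |-> exp (u t), with u = 4 a s,
    tend to 2 u, and both D k and its square integrate explicitly; the
    exponential moments themselves provide the dominating functions. *)
Lemma gaussian_moments a L F : dot L L = 1 -> gaussian_along a L F -> a != 0 ->
  sqintegrable mu F ->
  [/\ rintegrable mu (fun x => dot L x ^+ 2 * F x ^+ 2),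
      \int[mu]_x (dot L x * F x ^+ 2) = 0 &
      4 * a * \int[mu]_x (dot L x ^+ 2 * F x ^+ 2) = \int[mu]_x F x ^+ 2].
Proof.
move=> LL FL a0 F2; have [mF iF] := F2.
pose u x := 4 * a * dot L x; pose W x := F x ^+ 2; pose m := \int[mu]_x W x.
have meas_u : measurable_fun setT u.
  by apply: measurable_funM => //; exact: measurable_dot.
have mW : measurable_fun setT W by exact: measurable_funX.
have W0 x : 0 <= W x by exact: sqr_ge0.
have iE t : rintegrable mu (fun x => expR (u x * t) * W x).
  by have [] := gaussian_laplace t LL FL F2.
have IE t : \int[mu]_x (expR (u x * t) * W x) = expR (2 * a * t ^+ 2) * m.
  by have [] := gaussian_laplace t LL FL F2.
pose t (k : nat) : R := k.+1%:R^-1.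
have t01 k : 0 < t k <= 1.
  by rewrite invr_gt0 ltr0n/= invf_le1// ler1n.
have t_neq0 k : t k != 0 by have /andP[/gt_eqF ->] := t01 k.
have t_cvg0 : t @ \oo --> (0 : R) by exact: cvg_harmonic.
pose D k x := (t k)^-1 * (expR (u x * t k) - expR (u x * - t k)).
have mD k : measurable_fun setT (D k).
  apply: measurable_funM => //; apply: measurable_funB;
    by apply: measurableT_comp => //; exact: measurable_funM.
(* E j dominates exp (j |u|) and is integrable against W. *)
pose E j x : R := expR (u x * j%:R) + expR (u x * - j%:R).
have iEW j : rintegrable mu (fun x => E j x * W x).
  by under eq_fun do rewrite mulrDl; exact: rintegrableD.
have expE j x : expR (`|u x| * j%:R) <= E j x.
  have [u0|u0] := leP 0 (u x); first by rewrite ger0_norm// lerDl expR_ge0.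
  by rewrite ltr0_norm// mulNr -mulrN lerDr expR_ge0.
have DE k x : `|D k x| <= 2 * expR (`|u x| * 2%:R).
  have /andP[t0 t1] := t01 k.
  rewrite normrM gtr0_norm ?invr_gt0// mulrC ler_pdivrMr//.
  have h1 := le_abs_expR_sub1 (u x * t k).
  have h2 := le_abs_expR_sub1 (u x * - t k).
  have yu : `|u x * t k| = `|u x| * t k by rewrite normrM (gtr0_norm t0).
  have yu' : `|u x * - t k| = `|u x| * t k by rewrite mulrN normrN.
  rewrite yu in h1; rewrite yu' in h2.
  have h3 : `|u x| * t k * expR (`|u x| * t k) <= t k * expR (`|u x| * 2).
    rewrite mulrAC mulrC ler_wpM2l ?(ltW t0)// mulr_natr mulr2n expRD.
    apply: ler_pM => //.
      by apply: le_trans (expR_ge1Dx _); rewrite lerDr.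
    by rewrite ler_expR ler_piMr.
  rewrite (_ : _ - _ = (expR (u x * t k) - 1) - (expR (u x * - t k) - 1)); last by ring.
  by apply: le_trans (ler_normB _ _) _; lra.
have cvgD x : (fun k => D k x) @ \oo --> 2 * u x.
  pose g s := expR (u x * s) - expR (u x * - s).
  have -> : (fun k => D k x) = (fun k => (t k)^-1 * (g (t k) - g 0)).
    by apply/funext => k; rewrite /D /g oppr0 subrr subr0.
  apply: cvg_difference_quotient => //.
  pose p : {poly R} := u x *: 'X.
  have -> : g = (expR \o horner p) - (expR \o horner (- p)).
    by apply/funext => s; rewrite !fctE /= /g /p !hornerE mulrN.
  have d1 := is_derive1_comp (is_derive_expR _) (is_derive_poly p 0).
  have d2 := is_derive1_comp (is_derive_expR _) (is_derive_poly (- p) 0).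
  apply: (is_derive_eq (is_deriveB d1 d2)).
  by rewrite /p derivN derivZ derivX !hornerE /= !oppr0 !expR0 /u; ring.
have mDW k : measurable_fun setT (fun x => D k x * W x) by exact: measurable_funM.
have mDDW k : measurable_fun setT (fun x => D k x ^+ 2 * W x).
  by apply: measurable_funM => //; exact: measurable_funX.
have cvgDW x : (fun k => D k x * W x) @ \oo --> 2 * u x * W x.
  by apply: cvgM => //; exact: cvg_cst.
have cvgDDW x : (fun k => D k x ^+ 2 * W x) @ \oo --> (2 * u x) ^+ 2 * W x.
  by apply: cvgM; [apply: cvgM|exact: cvg_cst].
have DW_le k x : `|D k x * W x| <= 2 * (E 2%N x * W x).
  rewrite normrM (ger0_norm (W0 x)) mulrA ler_wpM2r// (le_trans (DE k x))//.
  by rewrite ler_wpM2l.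
have DDW_le k x : `|D k x ^+ 2 * W x| <= 4 * (E 4%N x * W x).
  rewrite normrM (ger0_norm (W0 x)) mulrA ler_wpM2r// normrX.
  apply: (@le_trans _ _ ((2 * expR (`|u x| * 2%:R)) ^+ 2)).
    by rewrite lerXn2r ?nnegrE ?mulr_ge0 ?expR_ge0.
  rewrite exprMn -expRM_natl.
  apply: (@le_trans _ _ (4 * expR (`|u x| * 4%:R))); last by rewrite ler_wpM2l.
  rewrite (_ : 2%:R * (`|u x| * 2%:R) = `|u x| * 4%:R); last by ring.
  by rewrite ler_wpM2r ?expR_ge0// -natrX.
have I1 : \int[mu]_x (2 * u x * W x) = 0.
  have := cvg_Rintegral mDW cvgDW (rintegrableZ 2 (iEW 2%N)) DW_le.
  have -> : (fun k => \int[mu]_x (D k x * W x)) = cst 0.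
    apply/funext => k /=.
    have -> : (fun x => D k x * W x) = (fun x => (t k)^-1 *
        (expR (u x * t k) * W x - expR (u x * - t k) * W x)).
      by apply/funext => x; rewrite /D; ring.
    rewrite RintegralZl//; last exact: rintegrableB.
    by rewrite (RintegralB measurableT (iE _) (iE _)) !IE sqrrN subrr mulr0.
  by move=> /(cvg_unique (@Rhausdorff R) (cvg_cst 0)) <-.
have i2 := cvg_rintegrable mDDW cvgDDW (rintegrableZ 4 (iEW 4%N)) DDW_le.
have I2 : \int[mu]_x ((2 * u x) ^+ 2 * W x) = 16 * a * m.
  have := cvg_Rintegral mDDW cvgDDW (rintegrableZ 4 (iEW 4%N)) DDW_le.
  (* The integrals are difference quotients of g at the squared steps. *)
  pose g s := 2 * m * expR (8 * a * s).
  have -> : (fun k => \int[mu]_x (D k x ^+ 2 * W x)) =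
      (fun k => (t k ^+ 2)^-1 * (g (t k ^+ 2) - g 0)).
    apply/funext => k /=.
    have -> : (fun x => D k x ^+ 2 * W x) = (fun x => (t k ^+ 2)^-1 *
        (expR (u x * (2 * t k)) * W x + expR (u x * - (2 * t k)) * W x
         - 2 * (expR (u x * 0) * W x))).
      apply/funext => x; rewrite /D.
      rewrite (_ : u x * (2 * t k) = u x * t k + u x * t k); last by ring.
      rewrite (_ : u x * - (2 * t k) = u x * - t k + u x * - t k); last by ring.
      rewrite (_ : u x * 0 = u x * t k + u x * - t k); last by ring.
      by rewrite !expRD exprMn exprVn; ring.
    rewrite RintegralZl//; last first.
      by apply: rintegrableB => //; [exact: rintegrableD|exact: rintegrableZ].
    rewrite RintegralB//; [|exact: rintegrableD|exact: rintegrableZ].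
    rewrite (RintegralD measurableT (iE _) (iE _)) (RintegralZl _ measurableT (iE _)).
    rewrite !IE /g mulr0 expR0 sqrrN.
    rewrite expr0n /= mulr0 expR0.
    rewrite (_ : 2 * a * (2 * t k) ^+ 2 = 8 * a * t k ^+ 2); last by ring.
    by congr (_ * _); ring.
  move=> cvgI; have /(cvg_unique (@Rhausdorff R) cvgI) : 
      (fun k => (t k ^+ 2)^-1 * (g (t k ^+ 2) - g 0)) @ \oo --> 16 * a * m; last exact.
  apply: cvg_difference_quotient.
  - by rewrite -(mulr0 0); apply: cvgM.
  - by move=> k; rewrite expf_neq0.
  - pose p : {poly R} := (8 * a) *: 'X.
    have -> : g = (2 * m) \*: (expR \o horner p).
      by apply/funext => s; rewrite !fctE /= /g /p !hornerE.
    apply: (is_derive_eq (is_deriveZ _ (is_derive1_comp (is_derive_expR _)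
      (is_derive_poly p 0)))).
    by rewrite /p derivZ derivX !hornerE /= expR0 /GRing.scale/=; ring.
have i1 := cvg_rintegrable mDW cvgDW (rintegrableZ 2 (iEW 2%N)) DW_le.
have sW1 : (fun x => dot L x * F x ^+ 2) =
    (fun x => (8 * a)^-1 * (2 * u x * W x)).
  by apply/funext => x; rewrite /u /W; field.
have sW2 : (fun x => dot L x ^+ 2 * F x ^+ 2) =
    (fun x => (64 * a ^+ 2)^-1 * ((2 * u x) ^+ 2 * W x)).
  by apply/funext => x; rewrite /u /W; field.
rewrite sW1 sW2; split; first exact: rintegrableZ.
  by rewrite (RintegralZl _ measurableT i1) I1 mulr0.
by rewrite (RintegralZl _ measurableT i2) I2; transitivity m => //; field.
Qed.

End gaussian_moments.

(** * Weak derivatives and complex-valued functions *)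

Section weak_derivative.
Variables (R : realType) (d : nat).
Local Notation V := 'rV[R]_d.
Local Notation mu := (lebesgue_rV R d).
Implicit Types (F : V -> R) (L x : V).

(** Both sides have the same integral against every tensor product, by integration
    by parts along L, and both are square-integrable. *)
Lemma gaussian_weak_derivative a L F (G : 'I_d -> V -> R) :
  dot L L = 1 -> gaussian_along a L F -> a != 0 -> sqintegrable mu F ->
  (forall j, sqintegrable mu (G j)) ->
  (forall j M b, (forall i, smooth (b i)) -> supported M b ->
    \int[mu]_x (F x * partial j (tensor b) x) =
    - \int[mu]_x (G j x * tensor b x)) ->
  {ae mu, forall x, \sum_(j < d) L ord0 j * G j x = - (2 * a * dot L x * F x)}.
Proof.
move=> LL FL a0 F2 G2 weak.
pose S x := \sum_(j < d) L ord0 j * G j x.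
have S2 : sqintegrable mu S.
  rewrite /S; elim: (index_enum _) => [|j s IH].
    under eq_fun do rewrite big_nil.
    by split=> //; under eq_fun do rewrite expr0n/=; exact: integrable0.
  by under eq_fun do rewrite big_cons; apply: sqintegrableD => //; exact: sqintegrableZ.
have [isF _ _] := gaussian_moments LL FL a0 F2.
have sF2 : sqintegrable mu (fun x => dot L x * F x).
  split; first by apply: measurable_funM; [exact: measurable_dot|exact: F2.1].
  by under eq_fun do rewrite exprMn.
have H2 := sqintegrableD S2 (sqintegrableZ (2 * a) sF2).
have : {ae mu, forall x, S x + 2 * a * (dot L x * F x) = 0}.
  apply: (sqintegrable_ae0 H2) => M b sb bM.
  have b_cube (b' : 'I_d -> R -> R) : (forall i, smooth (b' i)) -> supported M b' ->
      forall F', sqintegrable mu F' -> rintegrable mu (fun x => F' x * tensor b' x).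
    move=> sb' bM' F' F2'; have [C _ HC] := tensor_le_cube sb' bM'.
    exact: sqintegrableM_cube F2' (measurable_tensor sb') HC.
  have bi := b_cube b sb bM.
  have E x : (S x + 2 * a * (dot L x * F x)) * tensor b x =
      S x * tensor b x + 2 * a * dot L x * F x * tensor b x by ring.
  rewrite (eq_fun E) RintegralD//; last 2 first.
  - exact: bi.
  - have := rintegrableZ (2 * a) (bi _ sF2); congr (rintegrable _ _).
    by apply/funext => x; ring.
  rewrite -(Rintegral_gaussian_parts LL FL F2 sb bM).
  have -> : (fun x => S x * tensor b x) =
      (fun x => \sum_(j < d) L ord0 j * (G j x * tensor b x)).
    by apply/funext => x; rewrite mulr_suml; apply: eq_bigr => j _; rewrite mulrA.
  have -> : (fun x => F x * 'D_L (tensor b) x) =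
      (fun x => \sum_(j < d) L ord0 j * (F x * partial j (tensor b) x)).
    apply/funext => x; rewrite derive_tensor// mulr_sumr.
    by apply: eq_bigr => j _; rewrite mulrCA.
  have iF j : rintegrable mu (fun x => F x * partial j (tensor b) x).
    rewrite partial_tensor//; apply: b_cube => //.
      exact: derive_factor_smooth.
    exact: derive_factor_supported.
  rewrite !Rintegral_sum; last 2 first.
  - by move=> j; exact: rintegrableZ.
  - by move=> j; apply: rintegrableZ; exact: bi.
  rewrite -big_split big1// => j _ /=.
  rewrite (RintegralZl _ measurableT (bi _ (G2 j))) (RintegralZl _ measurableT (iF j)).
  by rewrite (weak _ _ _ sb bM) mulrN subrr.
apply: filterS => x /eqP; rewrite addr_eq0 => /eqP SE.
by rewrite -[LHS]/(S x) SE mulrA.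
Qed.

End weak_derivative.

Section complex_valued.
Variables (R : realType) (d : nat).
Local Notation V := 'rV[R]_d.
Local Notation mu := (lebesgue_rV R d).
Implicit Types (f g : V -> R[i]) (x : V) (z : R[i]).

Lemma normc_sqr z : normc z ^+ 2 = complex.Re z ^+ 2 + complex.Im z ^+ 2.
Proof. by case: z => p q; rewrite /normc normc_def /= sqr_sqrtr// addr_ge0 ?sqr_ge0. Qed.

Lemma ReZ (r : R) z : complex.Re (r%:C * z) = r * complex.Re z.
Proof. by case: z => p q; simpc. Qed.

Lemma ImZ (r : R) z : complex.Im (r%:C * z) = r * complex.Im z.
Proof. by case: z => p q; simpc. Qed.

Lemma measurable_normc_sqr f : cmeasurable f ->
  measurable_fun setT (fun x => normc (f x) ^+ 2).
Proof.
move=> [mr mi]; under eq_fun do rewrite normc_sqr.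
by apply: measurable_funD; exact: measurable_funX.
Qed.

Lemma normc_ge0 z : 0 <= normc z.
Proof. by case: z => p q; rewrite /normc normc_def /= sqrtr_ge0. Qed.

Lemma Lnorm_normc f :
  ('N[mu]_2%:E [EFin \o (@normc R \o f)] `^ 2 = \int[mu]_x (normc (f x) ^+ 2)%:E)%E.
Proof.
rewrite powR_Lnorm//; apply: eq_integral => x _ /=.
by rewrite ger0_norm ?normc_ge0// powR_mulrn ?normc_ge0.
Qed.

(** When the integral is infinite both sides are 0, since [fine] sends +oo to 0. *)
Lemma L2norm_sqr f : L2norm f ^+ 2 = \int[mu]_x (normc (f x) ^+ 2).
Proof.
rewrite /Rintegral -Lnorm_normc /L2norm.
have := Lnorm_ge0 mu 2%:E (EFin \o (@normc R \o f)).
case: ('N[mu]_2%:E [_])%E => [r|_|//] /=; last first.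
  by rewrite expr0n /= pnatr_eq0.
by move=> r0; rewrite powR_mulrn.
Qed.

Lemma L2_sqintegrable f : L2 f ->
  sqintegrable mu (fun x => complex.Re (f x)) /\
  sqintegrable mu (fun x => complex.Im (f x)).
Proof.
move=> [cf Nf]; have [mr mi] := cf.
have iN : rintegrable mu (fun x => normc (f x) ^+ 2).
  apply/integrableP; split; first by apply/measurable_EFinP; exact: measurable_normc_sqr.
  under eq_integral => x _ do rewrite gee0_abs ?lee_fin ?sqr_ge0//.
  by rewrite -Lnorm_normc poweR_lty.
by split; split=> //; apply: le_rintegrable iN => [|x];
  rewrite ?ger0_norm ?sqr_ge0 ?normc_sqr ?lerDl ?lerDr ?sqr_ge0//;
  exact: measurable_funX.
Qed.

Lemma cmeasurable_cst z : cmeasurable (cst z : V -> R[i]).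
Proof. by split; exact: measurable_cst. Qed.

Lemma cmeasurableD f g : cmeasurable f -> cmeasurable g ->
  cmeasurable (fun x => f x + g x).
Proof.
move=> [fr fi] [gr gi]; split.
  rewrite (_ : (fun x => _) = (fun x => complex.Re (f x) + complex.Re (g x))).
    exact: measurable_funD.
  by apply/funext => x; case: (f x) (g x) => [p q] [p' q'].
rewrite (_ : (fun x => _) = (fun x => complex.Im (f x) + complex.Im (g x))).
  exact: measurable_funD.
by apply/funext => x; case: (f x) (g x) => [p q] [p' q'].
Qed.

Lemma cmeasurableM f g : cmeasurable f -> cmeasurable g ->
  cmeasurable (fun x => f x * g x).
Proof.
move=> [fr fi] [gr gi]; split.
  rewrite (_ : (fun x => _) = (fun x => complex.Re (f x) * complex.Re (g x)
                                   - complex.Im (f x) * complex.Im (g x))).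
    by apply: measurable_funB; exact: measurable_funM.
  by apply/funext => x; case: (f x) (g x) => [p q] [p' q'].
rewrite (_ : (fun x => _) = (fun x => complex.Re (f x) * complex.Im (g x)
                                 + complex.Im (f x) * complex.Re (g x))).
  by apply: measurable_funD; exact: measurable_funM.
by apply/funext => x; case: (f x) (g x) => [p q] [p' q'].
Qed.

Lemma cmeasurable_conj f : cmeasurable f -> cmeasurable (fun x => (f x)^*).
Proof.
move=> [fr fi]; split.
  rewrite (_ : (fun x => _) = (fun x => complex.Re (f x)))//.
  by apply/funext => x; case: (f x).
rewrite (_ : (fun x => _) = (fun x => - complex.Im (f x))); first exact: measurable_funN.
by apply/funext => x; case: (f x).
Qed.

Lemma cmeasurable_sum (I : Type) (s : seq I) (F : I -> V -> R[i]) :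
  (forall i, cmeasurable (F i)) -> cmeasurable (fun x => \sum_(i <- s) F i x).
Proof.
move=> mF; elim: s => [|i s IH].
  by under eq_fun do rewrite big_nil; exact: cmeasurable_cst.
by under eq_fun do rewrite big_cons; exact: cmeasurableD.
Qed.

Lemma ae_eq_Rintegral (F G : V -> R) : measurable_fun setT F ->
  measurable_fun setT G -> {ae mu, forall x, F x = G x} ->
  \int[mu]_x F x = \int[mu]_x G x.
Proof.
move=> mF mG FG; congr fine; apply: ae_eq_integral => //.
- exact/measurable_EFinP.
- exact/measurable_EFinP.
- by apply: filterS FG => x /= -> _.
Qed.

Lemma ae_eq_cintegral f g : cmeasurable f -> cmeasurable g ->
  {ae mu, forall x, f x = g x} -> cintegral f = cintegral g.
Proof.
move=> [fr fi] [gr gi] fg; rewrite /cintegral; congr Complex;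
  by apply: ae_eq_Rintegral => //; apply: filterS fg => x ->.
Qed.

Lemma Rintegral_eq0_ae (F : V -> R) : rintegrable mu F -> (forall x, 0 <= F x) ->
  \int[mu]_x F x = 0 -> {ae mu, forall x, F x = 0}.
Proof.
move=> iF F0 IF0.
have IF : (\int[mu]_x `|(F x)%:E| = 0)%E.
  under eq_integral => x _ do rewrite gee0_abs ?lee_fin ?F0//.
  by rewrite -[LHS]fineK ?integrable_fin_num//; congr EFin.
have := (ae_eq_integral_abs mu measurableT (measurable_int _ iF)).1 IF.
by apply: filterS => x /(_ I)[].
Qed.

End complex_valued.

(** * The uncertainty product *)

Section extremal.
Variables (R : realType) (d : nat).
Local Notation V := 'rV[R]_d.
Local Notation mu := (lebesgue_rV R d).
Variables (a : R) (L : V) (f : V -> R[i]).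
Hypotheses (LL : dot L L = 1) (a_neq0 : a != 0).
Hypotheses (FLr : gaussian_along a L (fun x => complex.Re (f x)))
           (FLi : gaussian_along a L (fun x => complex.Im (f x))).

Let W x := normc (f x) ^+ 2.

Lemma gaussian_moments_normc : L2 f ->
  [/\ rintegrable mu W,
      rintegrable mu (fun x => dot L x * W x),
      rintegrable mu (fun x => dot L x ^+ 2 * W x),
      \int[mu]_x (dot L x * W x) = 0 &
      4 * a * \int[mu]_x (dot L x ^+ 2 * W x) = \int[mu]_x W x].
Proof.
move=> f2; have [r2 i2] := L2_sqintegrable f2.
have [ir r1 rE] := gaussian_moments LL FLr a_neq0 r2.
have [ii i1 iE] := gaussian_moments LL FLi a_neq0 i2.
have WE : W = (fun x => complex.Re (f x) ^+ 2 + complex.Im (f x) ^+ 2).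
  by apply/funext => x; rewrite /W normc_sqr.
have iW : rintegrable mu W.
  by rewrite WE; apply: rintegrableD; [exact: r2.2|exact: i2.2].
have s_int (F : V -> R) : sqintegrable mu F ->
    rintegrable mu (fun x => dot L x ^+ 2 * F x ^+ 2) ->
    rintegrable mu (fun x => dot L x * F x ^+ 2).
  move=> F2 sF2; apply: le_rintegrable (rintegrableD F2.2 sF2) => [|x].
    apply: measurable_funM; first exact: measurable_dot.
    by apply: measurable_funX; exact: F2.1.
  rewrite normrM [X in _ * X <= _]ger0_norm ?sqr_ge0//.
  rewrite -(real_normK (num_real (dot L x))).
  have := sqr_ge0 (F x); move: (F x ^+ 2) `|dot L x| => w s w0.
  have := mulr_ge0 (sqr_ge0 (s - 1)) w0; have := mulr_ge0 (sqr_ge0 (s + 1)) w0.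
  by nra.
have W1 : (fun x => dot L x * W x) =
    (fun x => dot L x * complex.Re (f x) ^+ 2 + dot L x * complex.Im (f x) ^+ 2).
  by apply/funext => x; rewrite WE mulrDr.
have W2 : (fun x => dot L x ^+ 2 * W x) = (fun x =>
    dot L x ^+ 2 * complex.Re (f x) ^+ 2 + dot L x ^+ 2 * complex.Im (f x) ^+ 2).
  by apply/funext => x; rewrite WE mulrDr.
have ir1 := s_int _ r2 ir; have ii1 := s_int _ i2 ii.
rewrite W1 W2; split => //; try exact: rintegrableD.
  by rewrite (RintegralD measurableT ir1 ii1) r1 i1 addr0.
rewrite (RintegralD measurableT ir ii) mulrDr rE iE WE.
by rewrite (RintegralD measurableT r2.2 i2.2).
Qed.

(** The mean value vanishes because the first moment does. *)
Lemma variance_opA : L2 f ->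
  Defs.variance (opA L) f = (2 * pi) ^+ 2 * \int[mu]_x (dot L x ^+ 2 * W x).
Proof.
move=> f2; have [iW i1 i2 I1 _] := gaussian_moments_normc f2.
rewrite /Defs.variance (_ : L2inner _ _ = 0); last first.
  rewrite /L2inner /cintegral; apply/eqP; rewrite eq_complex /=;
    apply/andP; split; apply/eqP.
    rewrite -(mulr0 (2 * pi)) -I1 -(RintegralZl _ measurableT i1).
    apply: eq_Rintegral => x _; rewrite /opA /W normc_sqr.
    by case: (f x) => p q /=; ring.
  rewrite -[RHS](mul0r (fine (mu setT))) -Rintegral_cst//.
  apply: eq_Rintegral => x _; rewrite /opA.
  by case: (f x) => p q /=; ring.
rewrite L2norm_sqr.
have -> : (fun x => normc (opA L f x) ^+ 2) =
    (fun x => (2 * pi) ^+ 2 * (dot L x ^+ 2 * W x)).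
  apply/funext => x; rewrite /opA /W !normc_sqr ReZ ImZ; ring.
rewrite (RintegralZl _ measurableT i2).
by rewrite normc_sqr /= expr0n addr0 mul0r subr0.
Qed.

Lemma weak_partialP j : H1 f ->
  L2 (weak_partial j f) /\ weak_partial_of j f (weak_partial j f).
Proof. by move=> [_ /(_ j) fj]; exact: (xgetPex (fun=> 0) fj). Qed.

Lemma cmeasurable_opB : H1 f -> cmeasurable (opB L f).
Proof.
move=> fH; apply: cmeasurableM; first exact: cmeasurable_cst.
apply: cmeasurable_sum => j; apply: cmeasurableM; first exact: cmeasurable_cst.
by have [[]] := weak_partialP j fH.
Qed.

(** The real and imaginary parts of f are both Gaussian along L, so the weak
    derivative of f along L is - 2 a s f almost everywhere. *)
Lemma opB_ae : H1 f -> {ae mu, forall x,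
  opB L f x = (a / pi * dot L x)%:C * (- 'i * f x)}.
Proof.
move=> fH; have [f2 _] := fH; have [r2 i2] := L2_sqintegrable f2.
pose g j := weak_partial j f.
have g2 j := L2_sqintegrable (weak_partialP j fH).1.
have weak j M b : (forall i, smooth (b i)) -> supported M b ->
    (\int[mu]_x (complex.Re (f x) * partial j (tensor b) x) =
      - (\int[mu]_x (complex.Re (g j x) * tensor b x))) /\
    (\int[mu]_x (complex.Im (f x) * partial j (tensor b) x) =
      - (\int[mu]_x (complex.Im (g j x) * tensor b x))).
  move=> sb bM.
  have := (weak_partialP j fH).2 _ (test_function_tensor sb bM).
  rewrite /cintegral => /eqP; rewrite eq_complex /= => /andP[/eqP Er /eqP Ei].
  have ReM (h : V -> R[i]) (r : V -> R) :
      (fun x => complex.Re (h x * (r x)%:C)) = (fun x => complex.Re (h x) * r x).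
    by apply/funext => x; rewrite mulrC ReZ mulrC.
  have ImM (h : V -> R[i]) (r : V -> R) :
      (fun x => complex.Im (h x * (r x)%:C)) = (fun x => complex.Im (h x) * r x).
    by apply/funext => x; rewrite mulrC ImZ mulrC.
  by rewrite !ReM in Er; rewrite !ImM in Ei.
have Hr := gaussian_weak_derivative LL FLr a_neq0 r2 (fun j => (g2 j).1)
  (fun j M b sb bM => (weak j M b sb bM).1).
have Hi := gaussian_weak_derivative LL FLi a_neq0 i2 (fun j => (g2 j).2)
  (fun j M b sb bM => (weak j M b sb bM).2).
apply: filterS2 Hr Hi => x Sr Si.
have gE : weak_dir_deriv L f x = (- (2 * a * dot L x))%:C * f x.
  apply/eqP; rewrite eq_complex ReZ ImZ !mulNr -Sr -Si.
  rewrite /weak_dir_deriv (big_morph (@complex.Re R) (id1 := 0) (op1 := +%R))//;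
    last by case=> ? ? [].
  rewrite (big_morph (@complex.Im R) (id1 := 0) (op1 := +%R))//;
    last by case=> ? ? [].
  apply/andP; split; apply/eqP; apply: eq_bigr => j _; first exact: ReZ.
  exact: ImZ.
rewrite /opB gE -fmorphV.
have pi_neq0 : (pi : R) != 0 by rewrite gt_eqF ?pi_gt0.
case: (f x) => p q; simpc; move: (pi : R) pi_neq0 => w w0.
by congr Complex; field; exact: w0.
Qed.

Lemma variance_opB : H1 f ->
  Defs.variance (opB L) f = (a / pi) ^+ 2 * \int[mu]_x (dot L x ^+ 2 * W x).
Proof.
move=> fH; have [f2 _] := fH; have [cf _] := f2.
have [iW i1 i2 I1 _] := gaussian_moments_normc f2.
have cB := cmeasurable_opB fH; have aeB := opB_ae fH.
pose h x : R[i] := (a / pi * dot L x)%:C * (- 'i * f x).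
have ch : cmeasurable h.
  apply: cmeasurableM; last by apply: cmeasurableM => //; exact: cmeasurable_cst.
  split => /=; last exact: measurable_cst.
  by apply: measurable_funM => //; exact: measurable_dot.
rewrite /Defs.variance (_ : L2inner _ _ = 0); last first.
  rewrite /L2inner (@ae_eq_cintegral _ _ _ (fun x => h x * (f x)^*)); first last.
  - by apply: filterS aeB => x ->.
  - by apply: cmeasurableM => //; exact: cmeasurable_conj.
  - by apply: cmeasurableM => //; exact: cmeasurable_conj.
  rewrite /cintegral; apply/eqP; rewrite eq_complex /=;
    apply/andP; split; apply/eqP.
    rewrite -[RHS](mul0r (fine (mu setT))) -Rintegral_cst//.
    apply: eq_Rintegral => x _; rewrite /h.
    by case: (f x) => p q /=; ring.
  rewrite -(mulr0 (- (a / pi))) -I1 -(RintegralZl _ measurableT i1).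
  apply: eq_Rintegral => x _; rewrite /h /W normc_sqr.
  by case: (f x) => p q /=; ring.
rewrite L2norm_sqr normc_sqr /= expr0n addr0 mul0r subr0.
rewrite -(RintegralZl _ measurableT i2).
apply: ae_eq_Rintegral; first exact: measurable_normc_sqr.
  exact: rintegrable_measurable (rintegrableZ _ i2).
apply: filterS aeB => x ->.
by rewrite /W !normc_sqr; case: (f x) => p q /=; ring.
Qed.

(** The second moment M cancels, as 4 a M is the squared norm of f; it is nonzero
    because f is. *)
Lemma UP_gaussian_along : nonzero f -> H1 f -> UP L f = 1 / 4.
Proof.
move=> f0 fH; have [f2 _] := fH.
have [iW _ _ _ M2] := gaussian_moments_normc f2.
rewrite /UP variance_opA// variance_opB// /enorm LL sqrtr1 expr1n mul1r.
rewrite (_ : L2norm f ^+ 4 = (L2norm f ^+ 2) ^+ 2); last by rewrite -exprM.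
rewrite L2norm_sqr -/(W _) -M2.
set M := \int[mu]_x _.
have M_neq0 : M != 0.
  apply/eqP => M0; apply: f0.
  have IW0 : \int[mu]_x W x = 0 by rewrite -M2 -/M M0 mulr0.
  have := Rintegral_eq0_ae iW (fun x => sqr_ge0 _) IW0.
  apply: filterS => x /eqP; rewrite /W normc_sqr paddr_eq0 ?sqr_ge0// !sqrf_eq0.
  by case: (f x) => p q /= /andP[/eqP -> /eqP ->].
have pi_neq0 : (pi : R) != 0 by rewrite gt_eqF ?pi_gt0.
move: (pi : R) pi_neq0 => w w0; field.
by rewrite M_neq0 a_neq0.
Qed.

End extremal.

Theorem lemma3 (R : realType) (n : nat) (L : 'rV[R]_n.+1) (mu : R)
    (Phi : 'rV[R]_n -> R[i]) (f : 'rV[R]_n.+1 -> R[i])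
    (L1 : enorm L = 1) (mu0 : mu != 0)
    (RePhi : C1 (fun y => complex.Re (Phi y)))
    (ImPhi : C1 (fun y => complex.Im (Phi y)))
    (fE : forall x : 'rV[R]_n.+1,
      f x = (expR (- (2 * pi ^+ 2 / mu) * dot L x ^+ 2))%:C *
            Phi (\row_(j < n) (L ord0 (lift ord0 j) * x ord0 ord0
                               - L ord0 ord0 * x ord0 (lift ord0 j))))
    (f0 : nonzero f) (fA : domA f) (fB : domB f) :
  UP L f = 1 / 4.
Proof.
pose a : R := 2 * pi ^+ 2 / mu.
have a_neq0 : a != 0.
  have pi2 : (pi : R) ^+ 2 != 0 by rewrite expf_neq0// gt_eqF ?pi_gt0.
  by rewrite /a mulf_neq0 ?invr_eq0// mulf_neq0// pnatr_eq0.
have LL : dot L L = 1.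
  have LL0 : 0 <= dot L L by apply: sumr_ge0 => i _; rewrite -expr2 sqr_ge0.
  by rewrite -[LHS]sqr_sqrtr// -/(enorm L) L1 expr1n.
(* The linear forms inside Phi vanish on L, so translation along L only changes
   the exponential factor. *)
have fL x t : f (x + t *: L) =
    (expR (- a * (2 * dot L x * t + t ^+ 2)))%:C * f x.
  rewrite !fE mulrA -rmorphM -expRD; congr (_%:C * Phi _).
    by congr expR; rewrite dotDr dotZr LL /a; ring.
  by apply/rowP => j; rewrite !mxE; ring.
by apply: (UP_gaussian_along LL a_neq0) => // x t; rewrite fL ?ReZ ?ImZ.
Qed.
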